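(* Let $L,\nu,\alpha>0$, and let $u(x,t)$ be the solution of the three-dimensional Navier-Stokes-Voight system $$u_t+\nu Au+\alpha^2Au_t+B(u,u)=f,\qquad u(0)=u^{in},$$ on the periodic box $\Omega=[0,L]^3$, corresponding to an initial condition $u^{in}\in V$ and a time-independent forcing $f\in G^1_{\tau_0}$, for some $\tau_0>0$. Let $t_0\ge 0$ be such that $$\|u(t)\|\le M_1:=\frac{2|f|_{-1}}{\alpha\nu\sqrt{d_0}}\quad\text{for all } t\ge t_0,\qquad d_0=\Big(\frac1{\lambda_1}+\alpha^2\Big)^{-1}.$$ Then there exists a function $$v^\omega\in L^\infty([t_0,\infty),G^2_\tau),$$ for some $\tau>0$ depending only on $|f|_{1,\tau_0}$, $\nu$, $\lambda_1$ and $\alpha$, satisfying $$\lim_{t\to\infty}\|u(t)-v^\omega(t)\|=0.$$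
   Context: Function spaces: $\Omega=[0,L]^3$ with periodic boundary conditions. $\mathcal V$ is the set of vector-valued trigonometric polynomials $\varphi$ on the periodic box $\Omega$ with $\nabla\cdot\varphi=0$ and $\int_\Omega\varphi\,dx=0$. $H$ and $V$ are the closures of $\mathcal V$ in the $L^2(\Omega)$ and $H^1(\Omega)$ topologies, respectively. $P_\sigma:L^2\to H$ is the Helmholtz-Leray orthogonal projection and $A=-P_\sigma\triangle$ is the Stokes operator with domain $D(A)=(H^2(\Omega))^3\cap V$; in the periodic case $A=-\triangle$ on $D(A)$. $\lambda_1=(2\pi/L)^2$ is the smallest eigenvalue of $A$. Norms: with $u=\sum_{j\in\mathbb Z^3}u_je^{2\pi i j\cdot x/L}$ and $|u|^2=\sum_j|u_j|^2$ the norm in $H$, for $s\in\mathbb R$ let $V_s=D(A^{s/2})$ with norm $|u|_s=|A^{s/2}u|$, i.e. $|u|_s^2=\sum_{j\neq0}|u_j|^2(2\pi|j|/L)^{2s}$ (for negative $s$, $V_s$ is the dual of $V_{-s}$). Thus $V_0=H$, $V_1=V$, $V_{-1}=V'$, and $\|u\|:=|u|_1$. Gevrey spaces: for $\tau>0$ and $r\ge0$, $G^r_\tau:=D(A^{r/2}e^{\tau A^{1/2}})=\{u\in H: |A^{r/2}e^{\tau A^{1/2}}u|<\infty\}$, with norm $|u|_{r,\tau}=|A^{r/2}e^{\tau A^{1/2}}u|$. Nonlinear term: $B(w_1,w_2)=P_\sigma((w_1\cdot\nabla)w_2)$ for $w_1,w_2\in\mathcal V$, extended to a continuous bilinear map $B:V\times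 V\to V'$. The system is the functional form of $u_t-\nu\triangle u-\alpha^2\triangle u_t+(u\cdot\nabla)u+\nabla p=f$, $\nabla\cdot u=0$, $u(x,0)=u^{in}(x)$, with periodic boundary conditions, where $u$ is the velocity, $p$ the pressure, $\nu$ the kinematic viscosity and $\alpha$ a length scale parameter. It is known that for every $u^{in}\in V$ it has a unique global solution, and this solution satisfies $u\in L^\infty([0,\infty),V)$. *)

(* Defs.v *)
From HB Require Import structures.
From mathcomp Require Import all_boot all_order all_algebra.
From mathcomp Require Import all_classical all_reals all_analysis.
From mathcomp Require Import complex.

Set Implicit Arguments.
Unset Strict Implicit.
Unset Printing Implicit Defensive.

Import Order.TTheory GRing.Theory Num.Theory.
Import numFieldNormedType.Exports.

Local Open Scope classical_set_scope.
Local Open Scope ring_scope.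
Local Open Scope complex_scope.

(* A vector-valued L-periodic function (or distribution)
     u = \sum_j u_j e^{2 pi i j.x / L},  j in Z^3,
   is represented by the family of its Fourier coefficients; by Parseval the
   norm |u|^2 = \sum_j |u_j|^2 is the L^2 norm for the normalized measure
   L^-3 dx on the box [0,L]^3. *)
Notation freq := 'rV[int]_3.
Notation cvec R := 'rV[R[i]]_3.
Notation vfield R := (freq -> cvec R).

Section FourierFields.
Variables (R : realType) (L : R).
Implicit Types (u v w : vfield R) (j k : freq) (s r tau : R).

Definition vsq (z : cvec R) : R :=
  \sum_(a < 3) (complex.Re (z 0 a) ^+ 2 + complex.Im (z 0 a) ^+ 2).

(* 2 pi |j| / L; its square is the eigenvalue of - Laplacian at frequency j *)
Definition kappa j : R :=
  2 * pi / L * Num.sqrt (\sum_(a < 3) ((j 0 a)%:~R : R) ^+ 2).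

Definition lambda1 : R := (2 * pi / L) ^+ 2.

Definition partial (a : 'I_3) w : vfield R :=
  fun j => ('i * (2 * pi / L * (j 0 a)%:~R)%:C) *: w j.

Definition divergence w (j : freq) : R[i] := \sum_(a < 3) partial a w j 0 a.

Definition laplacian w : vfield R :=
  fun j => \sum_(a < 3) partial a (partial a w) j.

Definition real_field u := forall j (a : 'I_3), u (- j) 0 a = conjc (u j 0 a).

Definition mean_zero u := u 0 = 0.

Definition div_free u := forall j, divergence u j = 0.

Definition trig_poly : set (vfield R) :=
  [set u | [/\ finite_set [set j | u j != 0], real_field u,
               div_free u & mean_zero u]].

Definition L2norm u : \bar R := sqrte (\esum_(j in [set: freq]) (vsq (u j))%:E).

Definition H1norm u : \bar R :=
  sqrte (L2norm u ^+ 2 + \sum_(a < 3) L2norm (partial a u) ^+ 2)%E.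

Definition closure_in (N : vfield R -> \bar R) (S : set (vfield R)) :
    set (vfield R) :=
  [set u | forall eps : R, 0 < eps -> exists2 w, S w & (N (u - w)%R < eps%:E)%E].

Definition spaceH : set (vfield R) := closure_in L2norm trig_poly.
Definition spaceV : set (vfield R) := closure_in H1norm trig_poly.

(* A^{s/2} e^{tau A^{1/2}} as a Fourier multiplier on mean-zero fields *)
Definition Amul s tau u : vfield R :=
  fun j => if j == 0 then 0
           else (kappa j `^ s * expR (tau * kappa j))%:C *: u j.

Definition Vnorm s u : \bar R := L2norm (Amul s 0 u).

Definition Gnorm r tau u : \bar R := L2norm (Amul r tau u).

Definition gevrey r tau : set (vfield R) :=
  [set u | spaceH u /\ (Gnorm r tau u < +oo)%E].

(* V' = V_{-1}, the dual of V through the L^2 pairing *)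
Definition spaceV' : set (vfield R) :=
  [set u | [/\ real_field u, div_free u, mean_zero u &
               (Vnorm (-1) u < +oo)%E]].

(* The orthogonal projection onto H: at frequency j <> 0 it is the orthogonal
   projection of C^3 onto the complement of j, and it removes the mean. *)
Definition leray w : vfield R :=
  fun j => if j == 0 then 0
           else w j - \row_a (((\sum_(b < 3) (j 0 b)%:~R * w j 0 b) /
                               (\sum_(b < 3) (j 0 b)%:~R ^+ 2)) *
                              (j 0 a)%:~R).

Lemma leray_div_free w : div_free (leray w).
Proof.
move=> j; rewrite /divergence /partial /leray.
case: eqVneq => [_|j0]; first by rewrite big1 // => a _; rewrite !mxE mulr0.
set c := (\sum_b _) / _.
have s0 : \sum_(b < 3) ((j 0 b)%:~R : R[i]) ^+ 2 != 0.
  apply: contra j0 => /eqP s0; apply/eqP/rowP => a; rewrite mxE.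
  have : ((j 0 a)%:~R : R[i]) ^+ 2 = 0.
    apply: (psumr_eq0P _ s0) => // b _.
    by rewrite -rmorphXn /= ler0z sqr_ge0.
  by move/eqP; rewrite sqrf_eq0 intr_eq0 => /eqP.
rewrite (eq_bigr (fun a : 'I_3 => 'i * (2 * pi / L)%:C *
   ((j 0 a)%:~R * w j 0 a - c * (j 0 a)%:~R ^+ 2))).
  by rewrite -mulr_sumr sumrB -mulr_sumr divfK // subrr mulr0.
move=> a _; rewrite !mxE rmorphM /= rmorph_int -[LHS]mulrA -[RHS]mulrA.
by rewrite -[(_ * _ * (_ - _))]mulrA mulrBr [_ * (c * _)]mulrCA -expr2.
Qed.

Lemma leray_orthogonal w j (z : cvec R) : j != 0 ->
  \sum_(a < 3) (j 0 a)%:~R * z 0 a = 0 ->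
  \sum_(a < 3) (w j - leray w j) 0 a * conjc (z 0 a) = 0.
Proof.
move=> j0 jz; rewrite /leray (negPf j0) opprB addrC subrK.
set c := (\sum_b _) / _.
rewrite (eq_bigr (fun a => c * conjc ((j 0 a)%:~R * z 0 a))).
  by rewrite -mulr_sumr -rmorph_sum jz rmorph0 mulr0.
by move=> a _; rewrite mxE rmorphM /= rmorph_int mulrA.
Qed.

Definition stokes u : vfield R := leray (- laplacian u).

(* (w1 . nabla) w2 for trigonometric polynomials: products of functions are
   convolutions of Fourier coefficients, here with finitely many nonzero terms
   (\sum_(k \in _) is a sum over the support). *)
Definition advect w1 w2 : vfield R :=
  fun j => \sum_(a < 3) \sum_(k \in [set: freq])
             w1 k 0 a *: partial a w2 (j - k).

(* b = B(u, v), where B : V x V -> V' is the continuous extension of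
   B(w1, w2) = P_sigma ((w1 . nabla) w2) from trigonometric polynomials. *)
Definition B_ext u v (b : vfield R) : Prop :=
  spaceV' b /\
  forall w1 w2 : nat -> vfield R,
    (forall n, trig_poly (w1 n)) -> (forall n, trig_poly (w2 n)) ->
    Vnorm 1 (w1 n - u) @[n --> \oo] --> 0%E ->
    Vnorm 1 (w2 n - v) @[n --> \oo] --> 0%E ->
    Vnorm (-1) (leray (advect (w1 n) (w2 n)) - b) @[n --> \oo] --> 0%E.

(* du is the derivative of u : [0, oo) -> V at t (one-sided at t = 0) *)
Definition V_derivative (u : R -> vfield R) (t : R) (du : vfield R) : Prop :=
  Vnorm 1 ((h^-1)%:C *: (u (t + h) - u t) - du)
    @[h --> within [set h | 0 <= t + h] 0^'] --> 0%E.

Definition nsv_solution (nu alpha : R) (f uin : vfield R) (u : R -> vfield R) :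
    Prop :=
  u 0 = uin /\
  exists ut : R -> vfield R, forall t, 0 <= t ->
    [/\ spaceV (u t), spaceV (ut t), V_derivative u t (ut t) &
        exists2 b, B_ext (u t) (u t) b &
          ut t + nu%:C *: stokes (u t) + (alpha ^+ 2)%:C *: stokes (ut t) + b
          = f].

Definition half_line (t0 : R) : set R := `[t0, +oo[%classic.

Definition simple_on (t0 : R) (S : set (vfield R)) (g : R -> vfield R) : Prop :=
  [/\ finite_set (g @` half_line t0),
      forall t, half_line t0 t -> S (g t) &
      forall w, measurable (half_line t0 `&` g @^-1` [set w])].

(* g is in L^infty([t0, oo), G^r_tau): strongly (Bochner) measurable and
   essentially bounded *)
Definition Linfty_gevrey (t0 r tau : R) (g : R -> vfield R) : Prop :=
  [/\ forall t, t0 <= t -> gevrey r tau (g t),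
      exists2 s : nat -> R -> vfield R,
        forall n, simple_on t0 (gevrey r tau) (s n) &
        {ae (@lebesgue_measure R), forall t, t0 <= t ->
           Gnorm r tau (s n t - g t) @[n --> \oo] --> 0%E} &
      exists M : R, {ae (@lebesgue_measure R), forall t, t0 <= t ->
           (Gnorm r tau (g t) <= M%:E)%E}].

End FourierFields.

(* Main.v *)
Require Import Defs.
From mathcomp Require Import all_boot all_order all_algebra.
From mathcomp Require Import all_classical all_reals all_analysis.
From mathcomp Require Import complex ring lra zify.

(* Along a solution, each Fourier mode decays at a rate at least d > 0, up to
   a forcing term and a quadratic term which (1 + alpha^2 A)^-1 smooths.  One
   measures u(t) in V with the extra weight
     g(t, k) = (e^(-tau k) + e^(-delta (t - t0)))^-1,  delta = d / 4,
   which is comparable to min(e^(tau k), e^(delta (t - t0))).  At t = t0 it is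
   at most 1, so no regularity of u(t0) is needed; its logarithmic time
   derivative is at most delta, so the damping absorbs its growth; and it is
   submultiplicative up to a constant, so the nonlinearity maps the weighted
   space to itself.  On frequencies above a large rho the quadratic term has a
   small constant, because sum |j|^-4 converges over Z^3, and on frequencies
   below rho the weight is at most e as soon as tau rho <= 1; a continuity
   argument then bounds the weighted norm uniformly in time.  Consequently the
   truncation v(t) of u(t) to frequencies tau k <= delta floor(t - t0) is
   bounded in a Gevrey space, while the remainder is O(e^(-delta (t - t0)))
   in V. *)

Set Implicit Arguments.
Unset Strict Implicit.
Unset Printing Implicit Defensive.

Import Order.TTheory GRing.Theory Num.Theory.
Import numFieldNormedType.Exports.
Local Open Scope classical_set_scope.
Local Open Scope ring_scope.

(** * Sums, Gronwall and continuous induction *)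

(** The obstacle is that u(t0) lies only in V: with the full weight e^(tau k) its norm may be
    infinite, and B(u, u) is known only as a limit in V'. At a fixed time g is bounded by e^(delta
    (t - t0)), so weighted sums are finite by the V bound alone and V' errors in B can be made
    harmless. With a weight and a restriction to high frequencies, the cancellation of (B(u, u), u)
    is lost, and the quadratic term has size eta K^2, where K is the very bound being propagated.
    Hence the order of choices: K from the V bound, the forcing and the coefficients; then eta with
    486 eta K^2 <= 1; then rho, such that the sum of k_j^-2 k_(j-i)^-2 over frequencies above rho is
    at most eta for every shift i; tau last. This is not circular: low frequencies cost at most e^2
    M^2 whatever rho is. The weighted bound carries one power of k where G^2 asks for two; half of
    tau buys the missing one, so the final rate is tau / 2. Rounding t - t0 down freezes the cutoff
    on unit intervals, which lets v be approximated by sampling in time. *)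

Lemma sum_mul_sqr_le (R : realFieldType) (I : Type) (r : seq I) (a b : I -> R) :
  (\sum_(i <- r) a i * b i) ^+ 2 <=
  (\sum_(i <- r) a i ^+ 2) * (\sum_(i <- r) b i ^+ 2).
Proof.
elim: r => [|i r IH]; first by rewrite !big_nil mul0r expr0n.
rewrite !big_cons.
set S := \sum_(j <- r) a j * b j in IH *; set A := \sum_(j <- r) _ in IH *.
set B := \sum_(j <- r) _ in IH *.
have A0 : 0 <= A by apply: sumr_ge0 => j _; exact: sqr_ge0.
have B0 : 0 <= B by apply: sumr_ge0 => j _; exact: sqr_ge0.
move: (a i) (b i) => x y.
(* After expansion only the cross term is left; multiplied by A, it follows from [S ^+ 2 <= A * B]
   and [0 <= (x * S - y * A) ^+ 2]. *)
suff h : 2 * (x * y * S) <= x ^+ 2 * B + y ^+ 2 * A by nra.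
have [A00|An0] := eqVneq A 0.
  move: IH; rewrite A00 mul0r => S0.
  have -> : S = 0 by apply/eqP; rewrite -sqrf_eq0; apply/eqP/le_anti; rewrite S0 sqr_ge0.
  by rewrite !mulr0 addr0 mulr_ge0 ?sqr_ge0.
have Ap : 0 < A by rewrite lt_def An0.
rewrite -(ler_pM2l Ap).
have := sqr_ge0 (x * S - y * A).
have : x ^+ 2 * S ^+ 2 <= x ^+ 2 * (A * B) by rewrite ler_wpM2l ?sqr_ge0.
nra.
Qed.

Lemma ler_sum_uniq_support (R : realDomainType) (I : eqType) (s s' : seq I)
    (G : I -> R) : uniq s' -> (forall i, 0 <= G i) ->
  (forall i, i \notin s -> G i = 0) ->
  \sum_(i <- s') G i <= \sum_(i <- s) G i.
Proof.
elim: s' s G => [|i s' IH] s G us' G0 Gs.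
  by rewrite big_nil; apply: sumr_ge0.
move: us' => /= /andP[is' us'].
rewrite big_cons.
have [si|si] := boolP (i \in s); last first.
  by rewrite Gs // add0r; apply: IH.
have e : \sum_(k <- s') G k = \sum_(k <- s') (if k == i then 0 else G k).
  rewrite big_seq [RHS]big_seq; apply: eq_bigr => k ks'; case: eqVneq => // ki.
  by rewrite -ki ks' in is'.
have h := IH s (fun k => if k == i then 0 else G k) us' _ _.
rewrite e; apply: le_trans (lerD (lexx _) (h _ _)) _.
- by move=> k; case: eqP.
- by move=> k ks; case: eqP => // _; exact: Gs.
rewrite (perm_big _ (perm_to_rem si)) /= [leRHS](perm_big _ (perm_to_rem si)) /=.
rewrite !big_cons eqxx add0r lerD2l; apply: ler_sum => k _; by case: eqP.
Qed.

(** Take for [s0] a finite family whose sum is within eps of the supremum: a family disjoint from it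
    can add at most eps. *)
Lemma summable_tail (R : realType) (I : eqType) (a : I -> R) (C : R) :
  (forall i, 0 <= a i) ->
  (forall s, uniq s -> \sum_(i <- s) a i <= C) ->
  forall eps, 0 < eps -> exists s0 : seq I, forall s, uniq s ->
    (forall i, i \in s -> i \notin s0) -> \sum_(i <- s) a i <= eps.
Proof.
move=> a0 aC eps eps0.
pose S := [set x | exists2 s, uniq s & x = \sum_(i <- s) a i].
have supS : has_sup S.
  split; first by exists 0, [::]; rewrite ?big_nil.
  by exists C => _ [s us ->]; exact: aC.
have [_ [s0 us0 ->] lt0] := sup_adherent eps0 supS.
exists s0 => s us ss0.
have : \sum_(i <- s0 ++ s) a i <= sup S.
  apply: ub_le_sup; first exact: supS.2.
  exists (s0 ++ s) => //; rewrite cat_uniq us0 us andbT.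
  by apply/hasPn => i /ss0.
rewrite big_cat /=; lra.
Qed.

(** At the infimum of the failure set the first hypothesis still yields P, and the second carries P
    beyond it, a contradiction. The base case is the first hypothesis at [a], where its range is
    empty. *)
Lemma real_induction (R : realType) (a : R) (P : R -> Prop) :
  (forall t, a <= t -> (forall s, a <= s < t -> P s) -> P t) ->
  (forall t, a <= t -> (forall s, a <= s <= t -> P s) ->
     exists2 eta, 0 < eta & forall s, t <= s <= t + eta -> P s) ->
  forall t, a <= t -> P t.
Proof.
move=> Pl Pr t at_; apply: contrapT => nPt.
pose bad := [set s | a <= s /\ ~ P s].
have badt : bad t by [].
have lbad : has_lbound bad by exists a => s [].
have bad0 : bad !=set0 by exists t.
have ai : a <= inf bad by apply: lb_le_inf => // s [].
have Plt s : a <= s < inf bad -> P s.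
  move=> /andP[as_ si]; apply: contrapT => nPs.
  have : inf bad <= s by apply: ge_inf.
  by rewrite leNgt si.
have Pi_ := Pl _ ai Plt.
have [|eta eta0 Pi] := Pr _ ai.
  move=> s /andP[as_]; rewrite le_eqVlt => /orP[/eqP -> //|si].
  by apply: Plt; rewrite as_.
have : inf bad + eta <= inf bad.
  apply: lb_le_inf => // s [as_ nPs]; rewrite leNgt; apply/negP => si.
  apply: nPs; have [si'|si'] := ltP s (inf bad); first by apply: Plt; rewrite as_.
  by apply: Pi; rewrite si' ltW.
by rewrite gerDl leNgt eta0.
Qed.

(** The function [expR (d * t) * (E t - H)] is nonincreasing. Derivatives are asked only inside the
    interval, because at time 0 the solution has a one-sided derivative. *)
Lemma gronwall_max (R : realType) (E dE : R -> R) (a b d H : R) :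
  a <= b -> 0 < d ->
  {within `[a, b], continuous E} ->
  (forall t, t \in `]a, b[ -> is_derive t 1 E (dE t)) ->
  (forall t, t \in `]a, b[ -> dE t <= - d * E t + d * H) ->
  0 <= H -> 0 <= E a ->
  E b <= E a + H.
Proof.
move=> ab d0 cE DE leE H0 Ea0.
pose G t := expR (d * t) * (E t - H).
have cG : {within `[a, b], continuous G}.
  have cE' := (subspace_continuousP _ _).1 cE.
  apply: (proj2 (subspace_continuousP _ _)) => t tab; apply: cvgM; last first.
    by apply: cvgB; [exact: cE'|exact: cvg_cst].
  apply: cvg_within_filter.
  apply: (@continuous_comp _ _ _ (fun t => d * t) expR); last exact: continuous_expR.
  by apply: cvgM; [exact: cvg_cst|exact: cvg_id].
have DG t : t \in `]a, b[ ->
    is_derive t 1 G (expR (d * t) * (d * (E t - H) + dE t)).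
  move=> /DE Dt; rewrite /G; apply: is_derive_eq.
  rewrite /= /GRing.scale /=; ring.
have : G b <= G a.
  apply: (ler0_derive1_le_cc _ _ cG); rewrite ?bound_itvE //.
    by move=> t tab; have [] := DG t tab.
  move=> t tab; rewrite derive1E; have [_ ->] := DG t tab.
  rewrite mulr_ge0_le0 ?expR_ge0 //; have := leE t tab; nra.
rewrite /G => h.
have e1 : expR (d * a) <= expR (d * b) by rewrite ler_expR ler_wpM2l // ltW.
have p1 := expR_gt0 (d * a); have p2 := expR_gt0 (d * b).
rewrite leNgt; apply/negP => c.
move: h; apply/negP; rewrite -ltNge.
have h1 : expR (d * a) * (E a - H) < expR (d * a) * (E b - H).
  by rewrite ltr_pM2l //; lra.
apply: lt_le_trans h1 _; apply: ler_wpM2r => //; lra.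
Qed.

(** * Lattice sums and the truncated Gevrey weight *)

Lemma sum_convolution_le (R : realFieldType) (I : zmodType) (s F : seq I)
    (U kap : I -> R) (eta : R) :
  uniq s -> (forall i, i \notin s -> U i = 0) ->
  (forall i, \sum_(j <- F) kap j ^- 2 * kap (j - i) ^- 2 <= eta) ->
  \sum_(j <- F) kap j ^- 2 * (\sum_(k <- s) U k / kap k * U (j - k)) ^+ 2 <=
  eta * (\sum_(k <- s) U k ^+ 2) ^+ 2.
Proof.
(* Cauchy-Schwarz, leaving the weight 1 / kap k on the factor U (j - k). *)
move=> us Us Feta; set N := \sum_(k <- s) U k ^+ 2.
have N0 : 0 <= N by apply: sumr_ge0 => k _; exact: sqr_ge0.
have h j : (\sum_(k <- s) U k / kap k * U (j - k)) ^+ 2 <=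
           N * \sum_(i <- s) kap (j - i) ^- 2 * U i ^+ 2.
  under eq_bigr => k _ do rewrite -mulrA.
  apply: le_trans (sum_mul_sqr_le _ _ _) _; apply: ler_wpM2l => //.
  under eq_bigr => k _ do rewrite exprMn exprVn.
  pose G i := kap (j - i) ^- 2 * U i ^+ 2.
  have -> : \sum_(i <- s) kap i ^- 2 * U (j - i) ^+ 2 =
            \sum_(i <- [seq j - k | k <- s]) G i.
    by rewrite big_map; apply: eq_bigr => k _; rewrite /G subKr.
  apply: ler_sum_uniq_support.
  - by rewrite map_inj_uniq // => x y /addrI /oppr_inj.
  - by move=> i; rewrite /G mulr_ge0 ?invr_ge0 ?sqr_ge0.
  - by move=> i /Us; rewrite /G => ->; rewrite expr0n mulr0.
apply: (@le_trans _ _ (\sum_(j <- F) \sum_(i <- s)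
    N * (U i ^+ 2 * (kap j ^- 2 * kap (j - i) ^- 2)))).
  apply: ler_sum => j _.
  apply: le_trans (ler_wpM2l _ (h j)) _; first by rewrite invr_ge0 sqr_ge0.
  rewrite mulrCA mulr_sumr mulr_sumr; apply: ler_sum => i _.
  by rewrite le_eqVlt; apply/orP; left; apply/eqP; ring.
rewrite exchange_big /= expr2 mulrA [eta * N]mulrC -mulrA mulr_sumr mulr_sumr.
apply: ler_sum => i _; rewrite -mulr_sumr -mulr_sumr; apply: ler_wpM2l => //.
by rewrite mulrC; apply: ler_wpM2r; rewrite ?sqr_ge0.
Qed.

Definition nsq (R : pzRingType) (j : freq) : R := \sum_(a < 3) (j 0 a)%:~R ^+ 2.

Lemma size_int_cube (N : nat) (s : seq freq) : uniq s ->
  (forall j, j \in s -> forall a, (`|j 0%R a| <= N)%N) ->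
  (size s <= N.*2.+1 ^ 3)%N.
Proof.
move=> us sN.
pose phi (j : freq) : {ffun 'I_3 -> 'I_(N.*2.+1)} :=
  [ffun a => inord `|(j 0%R a + N)%R|%N].
have : uniq (map phi s).
  rewrite map_inj_in_uniq // => i j /sN iN /sN jN /ffunP e.
  apply/rowP => a; have := e a; rewrite !ffunE => /(congr1 val) /=.
  move: (i 0 a) (j 0 a) (iN a) (jN a) => x y xN yN.
  by rewrite !inordK ?ltnS; lia.
move=> /card_uniqP; rewrite size_map => <-.
by apply: leq_trans (max_card _) _; rewrite card_ffun !card_ord.
Qed.

Lemma nsq_ge0 (R : realDomainType) (j : freq) : 0 <= nsq R j.
Proof. by apply: sumr_ge0 => a _; exact: sqr_ge0. Qed.

Lemma nsq_ge (R : realDomainType) (j : freq) a : ((j 0 a)%:~R : R) ^+ 2 <= nsq R j.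
Proof.
by rewrite /nsq (bigD1 a) //= lerDl; apply: sumr_ge0 => b _; exact: sqr_ge0.
Qed.

Lemma lattice_sum_le (R : realType) (s : seq freq) : uniq s ->
  \sum_(j <- s) (nsq R j) ^- 2 <= 432.
Proof.
(* Induction over dyadic cubes: the n-th shell contributes O(2^-n). *)
suff h n : uniq s -> (forall j, j \in s -> forall a, (`|j 0%R a| < 2 ^ n)%N) ->
    \sum_(j <- s) (nsq R j) ^- 2 <= 432 * (1 - 2 ^- n).
  move=> us.
  pose m := \max_(j <- s) \max_(a < 3) `|j 0%R a|%N.
  apply: le_trans (h m us _) _; last first.
    have : 0 < (2 ^- m : R) by rewrite invr_gt0 exprn_gt0.
    lra.
  move=> j js a; apply: leq_ltn_trans (ltn_expl m (ltnSn 1)).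
  apply: (@leq_trans (\max_(a < 3) `|j 0%R a|%N)).
    by rewrite (bigD1 a) //= leq_maxl.
  by rewrite /m (perm_big _ (perm_to_rem js)) big_cons leq_maxl.
elim: n s => [|n IH] s us sn.
  (* For n = 0 only j = 0 is left, and its term vanishes because the inverse of 0 is 0. *)
  rewrite expr0 invr1 subrr mulr0 big_seq big1 // => j js.
  rewrite /nsq big1 ?expr0n ?invr0 // => a _.
  by have := sn _ js a; rewrite expn0 ltnS leqn0 absz_eq0 => /eqP ->; rewrite expr0n.
pose P (j : freq) := [forall a, `|j 0%R a|%N < 2 ^ n]%N.
rewrite (bigID P) /= -big_filter -[X in _ + X]big_filter.
have u2 : 0 < (2 : R) ^+ n by rewrite exprn_gt0.
have h1 : \sum_(j <- [seq j <- s | P j]) (nsq R j) ^- 2 <= 432 * (1 - 2 ^- n).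
  apply: IH; first exact: filter_uniq.
  by move=> j; rewrite mem_filter => /andP[/forallP ].
have h2 : \sum_(j <- [seq j <- s | ~~ P j]) (nsq R j) ^- 2 <=
    (size [seq j <- s | ~~ P j])%:R * (2 ^+ n) ^- 4.
  rewrite -sum1_size natr_sum mulr_suml big_seq [leRHS]big_seq; apply: ler_sum => j.
  rewrite mem_filter => /andP[/forallPn[a]]; rewrite -leqNgt => ja _.
  rewrite mul1r lef_pV2 ?posrE ?exprn_gt0 //; last first.
    apply: lt_le_trans (nsq_ge R j a); rewrite exprn_even_gt0 //= intr_eq0.
    by rewrite -absz_gt0; apply: leq_trans ja; rewrite expn_gt0.
  have -> : (4 = 2 * 2)%N by [].
  rewrite [leLHS]exprM lerXn2r ?nnegrE ?sqr_ge0 ?nsq_ge0 //.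
  apply: le_trans (nsq_ge R j a).
  rewrite -[leRHS]real_normK ?num_real // -intr_norm -abszE.
  rewrite lerXn2r ?nnegrE ?ler0z ?(ltW u2) //.
  by rewrite -natrX -[(2 ^ n)%:R]/((2 ^ n)%N%:Z%:~R) ler_int lez_nat.
(* The shell lies in a cube of side 4 * 2^n + 1 <= 6 * 2^n, and each term is at most 2^(-4n), so it
   contributes at most 216 * 2^-n. This is exactly the increment of 432 * (1 - 2^-n), whence 432 = 2
   * 6^3. *)
have h3 : ((size [seq j <- s | ~~ P j])%:R : R) <= 216 * (2 ^+ n) ^+ 3.
  have := @size_int_cube (2 ^ n.+1) [seq j <- s | ~~ P j] (filter_uniq _ us) _.
  move=> h; apply: (@le_trans _ _ (((2 ^ n.+1).*2.+1 ^ 3)%N%:R)).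
    rewrite ler_nat; apply: h => j; rewrite mem_filter => /andP[_ js] a.
    exact/ltnW/sn.
  rewrite -natrX -natrX -natrM ler_nat.
  have -> : (216 = 6 ^ 3)%N by [].
  rewrite -expnMn leq_exp2r // expnS; have : (0 < 2 ^ n)%N by rewrite expn_gt0.
  lia.
have h4 : (size [seq j <- s | ~~ P j])%:R / (2 ^+ n) ^+ 4 <=
    216 * (2 ^+ n) ^+ 3 / (2 ^+ n) ^+ 4 :> R.
  by apply: ler_wpM2r h3; rewrite invr_ge0 exprn_ge0 // ltW.
apply: le_trans (lerD h1 (le_trans h2 h4)) _.
rewrite [in leRHS]exprS.
have -> : 216 * (2 ^+ n) ^+ 3 / (2 ^+ n) ^+ 4 = 216 / 2 ^+ n :> R.
  by field; rewrite gt_eqF.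
have -> : (2 * 2 ^+ n)^-1 = 2^-1 / 2 ^+ n :> R by field; rewrite gt_eqF.
lra.
Qed.

Lemma lattice_tail (R : realType) (eta : R) : 0 < eta ->
  exists2 rho : R, 0 <= rho & forall s : seq freq, uniq s ->
    (forall j, j \in s -> rho < nsq R j) -> \sum_(j <- s) (nsq R j) ^- 2 <= eta.
Proof.
move=> eta0.
have [||s0 hs0] := @summable_tail R _ (fun j => nsq R j ^- 2) 432 _ _ _ eta0.
- by move=> j; rewrite invr_ge0 sqr_ge0.
- by move=> s; exact: lattice_sum_le.
exists (\sum_(j <- s0) nsq R j); first by apply: sumr_ge0 => j _; exact: nsq_ge0.
move=> s us hs; apply: hs0 => // j /hs; apply: contraTN => js0.
rewrite -leNgt (perm_big _ (perm_to_rem js0)) /= big_cons lerDl.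
by apply: sumr_ge0 => i _; exact: nsq_ge0.
Qed.

(** Cauchy-Schwarz bounds the square by a tail, made smaller than eta^2 / 432, times a shifted
    lattice sum, at most 432 for every shift; hence [rho] does not depend on i. *)
Lemma lattice_pair_tail (R : realType) (eta : R) : 0 < eta ->
  exists2 rho : R, 0 <= rho & forall s : seq freq, uniq s ->
    (forall j, j \in s -> rho < nsq R j) ->
    forall i, \sum_(j <- s) (nsq R j)^-1 * (nsq R (j - i))^-1 <= eta.
Proof.
move=> eta0.
have [|rho rho0 hrho] := @lattice_tail R (eta ^+ 2 / 432).
  by rewrite divr_gt0 ?exprn_gt0 ?ltr0n.
exists rho => // s us hs i.
rewrite -(@ler_pXn2r _ 2%N) ?nnegrE ?(ltW eta0) //; last first.
  by apply: sumr_ge0 => j _; rewrite mulr_ge0 ?invr_ge0 ?nsq_ge0.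
apply: le_trans (sum_mul_sqr_le _ _ _) _.
under eq_bigr do rewrite exprVn.
under [X in _ * X]eq_bigr do rewrite exprVn.
have -> : eta ^+ 2 = eta ^+ 2 / 432 * 432 by field.
apply: ler_pM.
- by apply: sumr_ge0 => j _; rewrite invr_ge0 sqr_ge0.
- by apply: sumr_ge0 => j _; rewrite invr_ge0 sqr_ge0.
- exact: hrho.
have -> : \sum_(j <- s) nsq R (j - i) ^- 2 =
          \sum_(j <- [seq j - i | j <- s]) nsq R j ^- 2 by rewrite big_map.
by apply: lattice_sum_le; rewrite map_inj_uniq // => x y /addIr.
Qed.

Section Weight.
Variables (R : realType) (tau : R).
Implicit Types z x y : R.

(* Smooth substitute for min(e^{tau x}, 1/z), submultiplicative up to a constant. *)
Definition gw z x : R := (expR (- (tau * x)) + z)^-1.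

Hypothesis tau0 : 0 <= tau.

Lemma gw_gt0 z x : 0 < z -> 0 < gw z x.
Proof. by move=> z0; rewrite invr_gt0 addr_gt0 ?expR_gt0. Qed.

Lemma gw_le_inv z x : 0 < z -> gw z x <= z^-1.
Proof.
by move=> z0; rewrite lef_pV2 ?posrE ?addr_gt0 ?expR_gt0 // lerDr expR_ge0.
Qed.

Lemma gw_le_exp z x : 0 < z -> gw z x <= expR (tau * x).
Proof.
move=> z0; rewrite -[expR (tau * x)]invrK -expRN.
by rewrite lef_pV2 ?posrE ?addr_gt0 ?expR_gt0 // lerDl ltW.
Qed.

Lemma gw_le_ratio z z' x : 0 < z -> z <= z' -> gw z x <= z' / z * gw z' x.
Proof.
move=> z0 zz'; have z'0 := lt_le_trans z0 zz'.
have e0 := expR_gt0 (- (tau * x)).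
rewrite /gw ler_pdivlMr ?addr_gt0 // mulrC ler_pdivrMr ?addr_gt0 //.
rewrite mulrAC ler_pdivlMr //; nra.
Qed.

(** With a, b, c the exponentials at y1, y2, x, one has a b <= c and a, b, z <= 1, so (a + z)(b + z)
    = a b + z (a + b + z) <= c + 3 z. *)
Lemma gw_submul z x y1 y2 : 0 < z <= 1 -> 0 <= y1 -> 0 <= y2 -> x <= y1 + y2 ->
  gw z x <= 3 * (gw z y1 * gw z y2).
Proof.
move=> /andP[z0 z1] y10 y20 xy.
have h1 : expR (- (tau * y1)) * expR (- (tau * y2)) <= expR (- (tau * x)).
  by rewrite -expRD ler_expR -opprD -mulrDr lerN2 ler_wpM2l.
have a1 : expR (- (tau * y1)) <= 1 by rewrite -expR0 ler_expR oppr_le0 mulr_ge0.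
have b1 : expR (- (tau * y2)) <= 1 by rewrite -expR0 ler_expR oppr_le0 mulr_ge0.
have a0 := expR_gt0 (- (tau * y1)); have b0 := expR_gt0 (- (tau * y2)).
have c0 := expR_gt0 (- (tau * x)).
rewrite /gw -invfM; move: h1 a1 b1 a0 b0 c0.
move: (expR (- (tau * y1))) (expR (- (tau * y2))) (expR (- (tau * x))).
move=> a b c h1 a1 b1 a0 b0 c0.
rewrite ler_pdivlMr ?mulr_gt0 ?addr_gt0 // [leLHS]mulrC.
rewrite ler_pdivrMr ?addr_gt0 //.
have : z * a <= z by rewrite ler_piMr // ltW.
have : z * b <= z by rewrite ler_piMr // ltW.
have : z * z <= z by rewrite ler_piMr // ltW.
lra.
Qed.

End Weight.

(** * Fourier fields *)

Lemma nbhs0_cvgeP (R : realType) (T : Type) (F : set_system T) (x : T -> \bar R) :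
  Filter F -> (forall t, 0 <= x t)%E ->
  x t @[t --> F] --> 0%E <->
  (forall eps : R, 0 < eps -> \forall t \near F, (x t <= eps%:E)%E).
Proof.
move=> FF x0; split.
  move=> xF eps eps0; apply: (xF [set y | (y <= eps%:E)%E]).
  change (\forall r \near (0 : R), (r%:E <= eps%:E)%E).
  exists eps => //= r /=; rewrite sub0r normrN lee_fin => /ltW.
  exact/le_trans/ler_norm.
move=> xF A [e /= e0 eA].
have := xF (e / 2) (divr_gt0 e0 (ltr0Sn _ 1)).
apply: filterS => t h; change (A (x t)).
move: h; have := x0 t; case: (x t) => [r||] //.
rewrite !lee_fin => r0 re; apply: eA => /=.
by rewrite sub0r normrN ger0_norm //; lra.
Qed.

Section Vsq.
Local Open Scope complex_scope.
Variable R : realType.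
Implicit Types (z w : cvec R) (c : R).

Lemma vsq_ge0 z : 0 <= vsq z.
Proof. by apply: sumr_ge0 => a _; rewrite addr_ge0 ?sqr_ge0. Qed.

Lemma vsqZ c z : vsq (c%:C *: z) = c ^+ 2 * vsq z.
Proof.
rewrite /vsq mulr_sumr; apply: eq_bigr => a _; rewrite !mxE.
by case: (z 0 a) => x y /=; ring.
Qed.

Lemma vsq0 : vsq (0 : cvec R) = 0.
Proof. by rewrite /vsq big1 // => a _; rewrite !mxE /= expr0n addr0. Qed.

Lemma vsqN z : vsq (- z) = vsq z.
Proof.
by apply: eq_bigr => a _; rewrite !mxE; case: (z 0 a) => x y /=; rewrite !sqrrN.
Qed.

(** The inner product of C^3 seen as R^6, that is, the real part of the Hermitian one; it arises
    when [vsq] is differentiated in time. *)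
Definition dotr z w : R :=
  \sum_(a < 3) (complex.Re (z 0 a) * complex.Re (w 0 a) +
                complex.Im (z 0 a) * complex.Im (w 0 a)).

Lemma vsqD z w : vsq (z + w) = vsq z + 2 * dotr z w + vsq w.
Proof.
rewrite /vsq /dotr mulr_sumr -!big_split /=; apply: eq_bigr => a _.
by rewrite !mxE; case: (z 0 a) (w 0 a) => [x y] [x' y'] /=; ring.
Qed.

Lemma dotrDr z w w' : dotr z (w + w') = dotr z w + dotr z w'.
Proof.
rewrite /dotr -big_split /=; apply: eq_bigr => a _.
by rewrite !mxE; case: (z 0 a) (w 0 a) (w' 0 a) => [x y] [x' y'] [x2 y2] /=; ring.
Qed.

Lemma dotrZr c z w : dotr z (c%:C *: w) = c * dotr z w.
Proof.
rewrite /dotr mulr_sumr; apply: eq_bigr => a _.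
by rewrite !mxE; case: (z 0 a) (w 0 a) => [x y] [x' y'] /=; ring.
Qed.

Lemma dotrr z : dotr z z = vsq z.
Proof. by apply: eq_bigr => a _; rewrite !expr2. Qed.

Lemma dotr_young c z w : 0 < c -> 2 * dotr z w <= c * vsq z + c^-1 * vsq w.
Proof.
move=> c0; rewrite /dotr /vsq !mulr_sumr -big_split /=; apply: ler_sum => a _.
case: (z 0 a) (w 0 a) => [x y] [x' y'] /=.
have h (u v : R) : 2 * (u * v) <= c * u ^+ 2 + c^-1 * v ^+ 2.
  rewrite -subr_ge0 (_ : _ - _ = c^-1 * (c * u - v) ^+ 2); last by field; rewrite gt_eqF.
  by rewrite mulr_ge0 ?sqr_ge0 // invr_ge0 ltW.
by have := h x x'; have := h y y'; lra.
Qed.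

Lemma vsqD_le z w : vsq (z + w) <= 2 * vsq z + 2 * vsq w.
Proof. by rewrite vsqD; have := @dotr_young 1 z w ltr01; rewrite invr1; lra. Qed.

Lemma vsqB_le z w : vsq (z - w) <= 2 * vsq z + 2 * vsq w.
Proof. by rewrite -(vsqN w); exact: vsqD_le. Qed.

Lemma normc_sqr (x : R[i]) :
  ComplexField.Normc.normc x ^+ 2 = complex.Re x ^+ 2 + complex.Im x ^+ 2.
Proof. by case: x => a b /=; rewrite sqr_sqrtr // addr_ge0 ?sqr_ge0. Qed.

Lemma vsq_ge_Re z a : complex.Re (z 0 a) ^+ 2 <= vsq z.
Proof.
rewrite /vsq (bigD1 a) //= -addrA lerDl addr_ge0 ?sqr_ge0 //.
by apply: sumr_ge0 => b _; rewrite addr_ge0 ?sqr_ge0.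
Qed.

Lemma vsq_ge_Im z a : complex.Im (z 0 a) ^+ 2 <= vsq z.
Proof.
rewrite /vsq (bigD1 a) //= addrAC addrC lerDl addr_ge0 ?sqr_ge0 //.
by apply: sumr_ge0 => b _; rewrite addr_ge0 ?sqr_ge0.
Qed.

Lemma vsq_ge_normc z a : ComplexField.Normc.normc (z 0 a) <= Num.sqrt (vsq z).
Proof.
rewrite -(@ler_pXn2r _ 2%N) ?nnegrE ?sqrtr_ge0 //; last first.
  by case: (z 0 a) => *; exact: sqrtr_ge0.
rewrite sqr_sqrtr ?vsq_ge0 // normc_sqr /vsq (bigD1 a) //= lerDl.
by apply: sumr_ge0 => b _; rewrite addr_ge0 ?sqr_ge0.
Qed.

Lemma vsq_eq0 z : (forall eps : R, 0 < eps -> vsq z <= eps) -> z = 0.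
Proof.
move=> h; apply/rowP => a; rewrite mxE.
have v0 : vsq z <= 0.
  by apply/ler_addgt0Pr => e e0; rewrite add0r; exact: h.
have := vsq_ge_Re z a; have := vsq_ge_Im z a.
case: (z 0 a) => x y /= y0 x0.
have /eqP : x ^+ 2 = 0 by apply/le_anti; rewrite sqr_ge0 (le_trans x0).
have /eqP : y ^+ 2 = 0 by apply/le_anti; rewrite sqr_ge0 (le_trans y0).
by rewrite !sqrf_eq0 => /eqP -> /eqP ->.
Qed.

End Vsq.

Section Norms.
Variables (R : realType) (L : R).
Hypothesis L0 : 0 < L.
Implicit Types (u v w : vfield R) (j k : freq) (s : seq freq).

(** A sum of nonnegative terms is the supremum of its finite partial sums. Norm estimates thus
    become estimates on finite real sums, which can be differentiated in time term by term. *)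
Lemma L2norm_leP w (M : R) : 0 <= M ->
  (L2norm w <= M%:E)%E <-> forall s, uniq s -> \sum_(j <- s) vsq (w j) <= M ^+ 2.
Proof.
move=> M0.
have -> : (L2norm w <= M%:E)%E =
    (\esum_(j in [set: freq]) (vsq (w j))%:E <= (M ^+ 2)%:E)%E.
  rewrite /L2norm -[RHS]lee_sqrt ?lee_fin ?sqr_ge0 //.
  by rewrite [sqrte (_ ^+ 2)%:E]/= sqrtr_sqr ger0_norm.
split=> [h s us|h].
  rewrite -lee_fin -sumEFin; apply: le_trans h; apply: esum_ge.
  exists [set` s]; first by split => //; exact: finite_seq.
  by rewrite -fsbig_seq.
apply: ge_ereal_sup => _ [A [finA _] <-].
by rewrite fsbig_finite //= sumEFin lee_fin; apply: h; exact: finmap.fset_uniq.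
Qed.

Lemma L2norm_ge0 w : (0 <= L2norm w)%E. Proof. exact: sqrte_ge0. Qed.
Lemma Vnorm_ge0 r w : (0 <= Vnorm L r w)%E. Proof. exact: sqrte_ge0. Qed.
Lemma Gnorm_ge0 r t w : (0 <= Gnorm L r t w)%E. Proof. exact: sqrte_ge0. Qed.

Lemma L0' : 0 < 2 * pi / L.
Proof. by rewrite divr_gt0 ?mulr_gt0 ?pi_gt0. Qed.

Lemma kappa_ge0 j : 0 <= kappa L j.
Proof. by rewrite mulr_ge0 ?sqrtr_ge0 ?ltW ?L0'. Qed.

Lemma kappa_sqr j : kappa L j ^+ 2 = lambda1 L * nsq R j.
Proof. by rewrite /kappa exprMn sqr_sqrtr // nsq_ge0. Qed.

Lemma lambda1_gt0 : 0 < lambda1 L.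
Proof. by rewrite exprn_gt0 ?L0'. Qed.

Lemma nsq_ge1 j : j != 0 -> 1 <= nsq R j.
Proof.
move=> j0; have /existsP[a ja] : [exists a, j 0 a != 0].
  apply: contraNT j0; rewrite negb_exists => /forallP h.
  by apply/eqP/rowP => a; rewrite mxE; have := h a; rewrite negbK => /eqP.
apply: le_trans (nsq_ge R j a).
rewrite -[leRHS]real_normK ?num_real // -intr_norm -abszE.
rewrite exprn_ege1 // -[1]/(1%:Z%:~R) ler_int lez_nat absz_gt0 //.
Qed.

Lemma kappa_sqr_ge j : j != 0 -> lambda1 L <= kappa L j ^+ 2.
Proof.
by move=> j0; rewrite kappa_sqr ler_peMr ?nsq_ge1 // ltW // lambda1_gt0.
Qed.

Lemma kappa_gt0 j : j != 0 -> 0 < kappa L j.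
Proof.
move=> j0; rewrite lt_def kappa_ge0 andbT; apply: contraTneq (kappa_sqr_ge j0).
by move=> ->; rewrite expr0n -ltNge lambda1_gt0.
Qed.

Lemma kappa0 : kappa L 0 = 0.
Proof.
by rewrite /kappa big1 ?sqrtr0 ?mulr0 // => a _; rewrite mxE expr0n.
Qed.

Lemma kappa_le_add j k : kappa L j <= kappa L k + kappa L (j - k).
Proof.
rewrite -(@ler_pXn2r _ 2%N) ?nnegrE ?addr_ge0 ?kappa_ge0 //.
rewrite sqrrD !kappa_sqr.
have h : (\sum_(a < 3) (k 0 a)%:~R * ((j - k) 0 a)%:~R : R) * lambda1 L <=
    kappa L k * kappa L (j - k).
  set S := \sum_(a < 3) _.
  have [S0|S0] := leP S 0.
    apply: (@le_trans _ _ 0); last by rewrite mulr_ge0 ?kappa_ge0.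
    by rewrite mulr_le0_ge0 // ltW // lambda1_gt0.
  have l0 := ltW lambda1_gt0.
  have p1 : 0 <= S * lambda1 L by rewrite mulr_ge0 // ltW.
  have p2 : 0 <= kappa L k * kappa L (j - k) by apply: mulr_ge0; exact: kappa_ge0.
  rewrite -(@ler_pXn2r _ 2%N) //.
  rewrite [(S * _) ^+ 2]exprMn [(kappa L k * _) ^+ 2]exprMn !kappa_sqr.
  rewrite (_ : lambda1 L * _ * _ = nsq R k * nsq R (j - k) * lambda1 L ^+ 2);
    last by ring.
  rewrite ler_wpM2r ?sqr_ge0 //.
  exact: sum_mul_sqr_le.
have e : nsq R j = nsq R k + 2 * (\sum_(a < 3) (k 0 a)%:~R * ((j - k) 0 a)%:~R) +
    nsq R (j - k).
  rewrite /nsq mulr_sumr -!big_split /=; apply: eq_bigr => a _.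
  by rewrite !mxE intrB; ring.
rewrite e -mulr_natl; lra.
Qed.

Lemma vsq_Amul r t u j :
  vsq (Amul L r t u j) =
  if j == 0 then 0 else (kappa L j `^ r * expR (t * kappa L j)) ^+ 2 * vsq (u j).
Proof. by rewrite /Amul; case: eqP => _; rewrite ?vsq0 ?vsqZ. Qed.

(** A positive exponent removes the special case j = 0: [Amul] is 0 there by definition, and so is
    the power of [kappa]. *)
Lemma Gnorm_leP n t u (M : R) : 0 <= M -> (0 < n)%N ->
  (Gnorm L n%:R t u <= M%:E)%E <-> forall s, uniq s ->
    \sum_(j <- s) (kappa L j ^+ n * expR (t * kappa L j)) ^+ 2 * vsq (u j) <= M ^+ 2.
Proof.
move=> M0 n0; rewrite /Gnorm L2norm_leP //.
have e j : vsq (Amul L n%:R t u j) =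
    (kappa L j ^+ n * expR (t * kappa L j)) ^+ 2 * vsq (u j).
  rewrite vsq_Amul powR_mulrn ?kappa_ge0 //; case: eqP => // ->.
  by rewrite kappa0 expr0n eqn0Ngt n0 !mul0r expr0n mul0r.
by split=> h s us; have := h s us; rewrite (eq_bigr _ (fun j _ => e j)).
Qed.

Lemma Vnorm1_leP u (M : R) : 0 <= M ->
  (Vnorm L 1 u <= M%:E)%E <-> forall s, uniq s ->
    \sum_(j <- s) kappa L j ^+ 2 * vsq (u j) <= M ^+ 2.
Proof.
move=> M0; have := @Gnorm_leP 1 0 u M M0 isT; rewrite /Gnorm /Vnorm => ->.
have e j : (kappa L j ^+ 1 * expR (0 * kappa L j)) ^+ 2 * vsq (u j) =
    kappa L j ^+ 2 * vsq (u j).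
  by rewrite mul0r expR0 mulr1 expr1.
by split=> h s us; have := h s us; rewrite (eq_bigr _ (fun j _ => e j)).
Qed.

Lemma VnormN1_leP u (M : R) : 0 <= M ->
  (Vnorm L (-1) u <= M%:E)%E <-> forall s, uniq s ->
    \sum_(j <- s) kappa L j ^- 2 * vsq (u j) <= M ^+ 2.
Proof.
move=> M0; rewrite /Vnorm L2norm_leP //.
have e j : vsq (Amul L (-1) 0 u j) = kappa L j ^- 2 * vsq (u j).
  rewrite vsq_Amul powR_inv1 ?kappa_ge0 // mul0r expR0 mulr1 exprVn.
  by case: eqP => // ->; rewrite kappa0 expr0n invr0 mul0r.
by split=> h s us; have := h s us; rewrite (eq_bigr _ (fun j _ => e j)).
Qed.

End Norms.

(** * The nonlinear term *)

Notation normc := ComplexField.Normc.normc.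

Lemma normc_ge0 (R : realType) (x : R[i]) : 0 <= normc x.
Proof. by case: x => a b; exact: sqrtr_ge0. Qed.

Section Operators.
Local Open Scope complex_scope.
Variables (R : realType) (L : R).
Hypothesis L0 : 0 < L.
Implicit Types (u v w : vfield R) (j k : freq) (s : seq freq).

Lemma freq_orthogonal u j : div_free L u ->
  \sum_(a < 3) (j 0 a)%:~R * u j 0 a = 0.
Proof.
move=> /(_ j); rewrite /divergence /partial.
rewrite (eq_bigr (fun a : 'I_3 => 'i * (2 * pi / L)%:C * ((j 0 a)%:~R * u j 0 a)));
  last by move=> a _; rewrite mxE rmorphM /= rmorph_int !mulrA.
rewrite -mulr_sumr => /eqP; rewrite !mulf_eq0.
have -> : ('i == 0 :> R[i]) = false by rewrite eq_complex /= oner_eq0 andbF.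
have -> : ((2 * pi / L)%:C == 0 :> R[i]) = false.
  by rewrite eq_complex /= gt_eqF // L0'.
by move=> /eqP.
Qed.

(** Pythagoras: [leray w j] is orthogonal to j, hence to the part that the projection removes. *)
Lemma vsq_leray w j : vsq (leray w j) <= vsq (w j).
Proof.
have [->|j0] := eqVneq j 0; first by rewrite /leray eqxx vsq0 vsq_ge0.
have := leray_orthogonal w j0 (freq_orthogonal j (leray_div_free L w)).
set y := leray w j; set x := w j => h.
have e : dotr y (x - y) = 0.
  transitivity (complex.Re (\sum_(a < 3) (x - y) 0 a * conjc (y 0 a))); last by rewrite h.
  rewrite (raddf_sum (@complex.Re R : {additive Rcomplex R -> R})).
  rewrite /dotr; apply: eq_bigr => a _.
  by case: (y 0 a) ((x - y) 0 a) => [p q] [p' q'] /=; ring.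
have -> : x = y + (x - y) by rewrite addrC subrK.
by rewrite vsqD e mulr0 addr0 lerDl vsq_ge0.
Qed.

Lemma stokesE u j : div_free L u -> u 0 = 0 ->
  stokes L u j = (kappa L j ^+ 2)%:C *: u j.
Proof.
move=> du u0; have lapE : laplacian L u j = - ((kappa L j ^+ 2)%:C *: u j).
  rewrite /laplacian /partial kappa_sqr /nsq /lambda1 mulr_sumr rmorph_sum.
  rewrite scaler_suml -sumrN; apply: eq_bigr => a _.
  rewrite scalerA -scaleNr; congr (_ *: _).
  set c := 2 * pi / L; rewrite mulrACA -expr2 sqr_i -rmorphM mulN1r.
  by congr (- _%:C); ring.
rewrite /stokes /leray; case: eqP => [->|_]; first by rewrite u0 scaler0.
have -> : (- laplacian L u) j = (kappa L j ^+ 2)%:C *: u j.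
  by rewrite -[LHS]/(- (laplacian L u j)) lapE opprK.
rewrite (_ : \sum_(b < 3) _ = 0); last first.
  rewrite (eq_bigr (fun b => (kappa L j ^+ 2)%:C * ((j 0 b)%:~R * u j 0 b))).
    by rewrite -mulr_sumr freq_orthogonal ?mulr0.
  by move=> b _; rewrite mxE mulrCA.
by apply/rowP => a; rewrite !mxE !mul0r subr0.
Qed.

Lemma normc_sum (I : Type) (r : seq I) (P : pred I) (F : I -> R[i]) :
  normc (\sum_(i <- r | P i) F i) <= \sum_(i <- r | P i) normc (F i).
Proof.
apply: (big_ind2 (fun x y => normc x <= y)).
- by rewrite ComplexField.Normc.normc0.
- by move=> x x' y y' h h'; apply: le_trans (le_normcD _ _) _; exact: lerD.
- by [].
Qed.

Lemma normc_real (c : R) : normc c%:C = `|c|.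
Proof. by rewrite /= expr0n addr0 sqrtr_sqr. Qed.

Lemma abs_freq_le_kappa j a : `|2 * pi / L * (j 0 a)%:~R| <= kappa L j.
Proof.
have l0 := ltW (L0' L0).
rewrite /kappa normrM (ger0_norm l0) ler_wpM2l //.
by rewrite -sqrtr_sqr ler_sqrt ?nsq_ge0 // nsq_ge.
Qed.

Lemma normc_advect_le u v s j b : uniq s -> (forall k, k \notin s -> u k = 0) ->
  normc (advect L u v j 0 b) <=
  3 * \sum_(k <- s) Num.sqrt (vsq (u k)) *
                    (kappa L (j - k) * Num.sqrt (vsq (v (j - k)))).
Proof.
move=> us su.
have -> : advect L u v j = \sum_(a < 3) \sum_(k <- s) u k 0 a *: partial L a v (j - k).
  rewrite /advect; apply: eq_bigr => a _; rewrite (fsbigE s _ us) //.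
    by apply: eq_bigl => k; rewrite in_setT.
  by move=> k _ ks; rewrite su // mxE scale0r.
rewrite summxE; apply: le_trans (normc_sum _ _ _) _.
have -> : 3 = \sum_(a < 3) (1 : R) by rewrite sumr_const card_ord.
rewrite mulr_suml; apply: ler_sum => a _; rewrite mul1r summxE.
apply: le_trans (normc_sum _ _ _) _; apply: ler_sum => k _.
rewrite /partial !mxE !ComplexField.Normc.normcM.
apply: ler_pM; rewrite ?vsq_ge_normc //.
- exact: normc_ge0.
- by rewrite !mulr_ge0 ?normc_ge0.
apply: ler_pM; rewrite ?vsq_ge_normc //.
- by rewrite mulr_ge0 ?normc_ge0.
- exact: normc_ge0.
rewrite normc_real /= expr0n add0r expr1n sqrtr1 mul1r.
by have := abs_freq_le_kappa (j - k) a; rewrite !mxE.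
Qed.

(** By [gw_submul] and the triangle inequality for frequencies, the weight splits over the two
    factors and leaves a plain convolution of [U]. The constant is 3 * 9^2: each 9 is 3 from
    [gw_submul] times 3 directions of differentiation, and the outer 3 counts the components of the
    result. *)
Lemma sum_advect_le (tau z eta : R) w s (F : seq freq) :
  0 <= tau -> 0 < z <= 1 -> uniq s -> (forall k, k \notin s -> w k = 0) ->
  w 0 = 0 ->
  (forall i, \sum_(j <- F) kappa L j ^- 2 * kappa L (j - i) ^- 2 <= eta) ->
  \sum_(j <- F) gw tau z (kappa L j) ^+ 2 *
    (kappa L j ^- 2 * vsq (leray (advect L w w) j)) <=
  243 * (eta * (\sum_(k <- s) kappa L k ^+ 2 *
     (gw tau z (kappa L k) ^+ 2 * vsq (w k))) ^+ 2).
Proof.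
move=> tau0 zz us ws w0 Feta; have z0 : 0 < z by case/andP: zz.
pose U k := kappa L k * gw tau z (kappa L k) * Num.sqrt (vsq (w k)).
have Us k : k \notin s -> U k = 0.
  by move=> /ws wk; rewrite /U wk vsq0 sqrtr0 mulr0.
have U2 k : U k ^+ 2 = kappa L k ^+ 2 * (gw tau z (kappa L k) ^+ 2 * vsq (w k)).
  by rewrite -[in RHS](sqr_sqrtr (vsq_ge0 (w k))) /U; ring.
rewrite -(eq_bigr _ (fun k _ => U2 k)).
apply: le_trans (ler_wpM2l _ (sum_convolution_le us Us Feta)); last exact: ler0n.
rewrite mulr_sumr; apply: ler_sum => j _.
rewrite mulrCA [leRHS]mulrCA; apply: ler_wpM2l.
  by rewrite invr_ge0 exprn_ge0 ?kappa_ge0.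
set T := \sum_(k <- s) _.
have h b : gw tau z (kappa L j) * normc (advect L w w j 0 b) <= 9 * T.
  apply: le_trans (ler_wpM2l (ltW (gw_gt0 _ _ z0)) (normc_advect_le _ _ _ us ws)) _.
  rewrite /T !mulr_sumr; apply: ler_sum => k _.
  have [->|k0] := eqVneq k 0.
    by rewrite w0 vsq0 sqrtr0 !mul0r /U w0 vsq0 sqrtr0 !mulr0 !mul0r mulr0.
  have k0' := kappa_gt0 L0 k0.
  have -> : U k / kappa L k = gw tau z (kappa L k) * Num.sqrt (vsq (w k)).
    by rewrite /U; field; rewrite gt_eqF.
  rewrite /U.
  have := gw_submul tau0 zz (kappa_ge0 L0 k) (kappa_ge0 L0 (j - k)) (kappa_le_add L0 j k).
  set n := Num.sqrt (vsq (w k)); set n' := Num.sqrt _.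
  have n0 : 0 <= n by exact: sqrtr_ge0.
  have n'0 : 0 <= n' by exact: sqrtr_ge0.
  move=> /(ler_wpM2r (mulr_ge0 n0 (mulr_ge0 (kappa_ge0 L0 (j - k)) n'0))).
  lra.
have h2 b : gw tau z (kappa L j) ^+ 2 * normc (advect L w w j 0 b) ^+ 2 <= 81 * T ^+ 2.
  have -> : 81 * T ^+ 2 = (9 * T) ^+ 2 by ring.
  have p : 0 <= gw tau z (kappa L j) * normc (advect L w w j 0 b).
    by rewrite mulr_ge0 ?normc_ge0 // ltW // gw_gt0.
  by rewrite -exprMn lerXn2r ?nnegrE // (le_trans p).
apply: le_trans (ler_wpM2l (sqr_ge0 _) (vsq_leray _ _)) _.
have -> : vsq (advect L w w j) = \sum_b normc (advect L w w j 0 b) ^+ 2.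
  by apply: eq_bigr => b _; rewrite normc_sqr.
rewrite mulr_sumr; apply: le_trans (ler_sum _ (fun b _ => h2 b)) _.
by rewrite sumr_const card_ord -[_ *+ 3]mulr_natl; lra.
Qed.

Definition trunc u s : vfield R := fun j => if j \in s then u j else 0.

Lemma trunc_trig_poly u s : real_field u -> div_free L u -> mean_zero u ->
  (forall j, (- j \in s) = (j \in s)) -> trig_poly L (trunc u s).
Proof.
move=> ru du mu sN; split.
- apply: sub_finite_set (finite_seq s) => j /=.
  by rewrite /trunc; case: ifP => //; rewrite eqxx.
- move=> j a; rewrite /trunc sN; case: (j \in s); first exact: ru.
  by rewrite !mxE rmorph0.
- move=> j; rewrite /divergence /partial /trunc; case: (j \in s); first exact: du.
  by rewrite big1 // => a _; rewrite scaler0 mxE.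
- by rewrite /mean_zero /trunc mu if_same.
Qed.

(** [B_ext] can be tested only on trigonometric polynomials. A truncation of u is one once its
    frequency set is symmetric, as reality requires; adding the opposite frequencies can only shrink
    the remainder. *)
Lemma trunc_approx u (M : R) :
  real_field u -> div_free L u -> mean_zero u -> 0 <= M ->
  (Vnorm L 1 u <= M%:E)%E ->
  exists S : nat -> seq freq,
    [/\ forall n, uniq (S n), forall n, trig_poly L (trunc u (S n)) &
        Vnorm L 1 (trunc u (S n) - u) @[n --> \oo] --> 0%E].
Proof.
move=> ru du mu M0 /(Vnorm1_leP L0 _ M0) uM.
have [|S0 hS0] := @choice _ _ (fun (n : nat) (s0 : seq freq) => forall s, uniq s ->
    (forall i, i \in s -> i \notin s0) ->
    \sum_(i <- s) kappa L i ^+ 2 * vsq (u i) <= (n.+1%:R^-1 : R) ^+ 2).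
  move=> n; apply: summable_tail uM _ _.
    by move=> i; rewrite mulr_ge0 ?sqr_ge0 ?vsq_ge0.
  by rewrite exprn_gt0 // invr_gt0.
pose S n := undup (S0 n ++ map -%R (S0 n)).
have SN n j : (- j \in S n) = (j \in S n).
  rewrite !mem_undup !mem_cat orbC; congr (_ || _).
    by rewrite mem_map //; exact: oppr_inj.
  by rewrite -{2}[j]opprK mem_map //; exact: oppr_inj.
exists S; split.
- by move=> n; exact: undup_uniq.
- by move=> n; apply: trunc_trig_poly.
apply/nbhs0_cvgeP => [n|eps eps0]; first exact: Vnorm_ge0.
near=> n.
have n0 : 0 <= (n.+1%:R^-1 : R) by rewrite invr_ge0.
apply: (@le_trans _ _ (n.+1%:R^-1)%:E); last first.
  by rewrite lee_fin ltW //; near: n; exact: (near_infty_natSinv_lt (PosNum eps0)).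
apply/(Vnorm1_leP L0 _ n0) => s us.
apply: le_trans (hS0 n [seq j <- s | j \notin S0 n] (filter_uniq _ us) _); last first.
  by move=> i; rewrite mem_filter => /andP[].
rewrite big_filter (bigID (fun j => j \notin S0 n)) /= [X in _ + X]big1 ?addr0.
  apply: ler_sum => j _; apply: ler_wpM2l; first exact: sqr_ge0.
  rewrite -[(_ - _) j]/(trunc u (S n) j - u j) /trunc; case: ifP => _.
    by rewrite subrr vsq0 vsq_ge0.
  by rewrite sub0r vsqN.
move=> j; rewrite negbK => jS.
rewrite -[(_ - _) j]/(trunc u (S n) j - u j) /trunc mem_undup mem_cat jS /=.
by rewrite subrr vsq0 mulr0.
Unshelve. all: by end_near.
Qed.

(** The field b is compared with one approximant that is z / 2 close in V'. Since the weight is at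
    most 1 / z, the error costs at most 1 / 4 in the weighted sum. Splitting the square doubles both
    parts: 486 = 2 * 243, and 2 / 4 <= 1. *)
Lemma B_ext_weighted_le (tau z eta M K : R) u b (F : seq freq) :
  0 <= tau -> 0 < z <= 1 ->
  real_field u -> div_free L u -> mean_zero u -> 0 <= M ->
  (Vnorm L 1 u <= M%:E)%E -> B_ext L u u b -> uniq F ->
  (forall i, \sum_(j <- F) kappa L j ^- 2 * kappa L (j - i) ^- 2 <= eta) ->
  0 <= eta ->
  (forall s, uniq s -> \sum_(j <- s) kappa L j ^+ 2 *
     (gw tau z (kappa L j) ^+ 2 * vsq (u j)) <= K) ->
  \sum_(j <- F) gw tau z (kappa L j) ^+ 2 * (kappa L j ^- 2 * vsq (b j)) <=
  486 * (eta * K ^+ 2) + 1.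
Proof.
move=> tau0 zz ru du mu M0 uM [_ hB] uF Feta eta0 uK.
have z0 : 0 < z by case/andP: zz.
have [S [uS tS cS]] := trunc_approx ru du mu M0 uM.
have := hB _ _ tS tS cS cS.
have e0 : 0 < z / 2 by rewrite divr_gt0.
move=> /nbhs0_cvgeP -/(_ (fun _ => Vnorm_ge0 _ _ _) _ e0) [n _ /(_ n (leqnn n)) /=].
move=> /(VnormN1_leP L0 _ (ltW e0)) /(_ F uF).
set x := leray _ => hx.
have hx2 : \sum_(j <- F) gw tau z (kappa L j) ^+ 2 * (kappa L j ^- 2 * vsq (x j)) <=
    243 * (eta * K ^+ 2).
  apply: le_trans (sum_advect_le tau0 zz (uS n) _ _ Feta) _.
  - by move=> k kS; rewrite /trunc (negPf kS).
  - by rewrite /trunc mu if_same.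
  apply: ler_wpM2l => //; apply: ler_wpM2l => //.
  have e : \sum_(k <- S n) kappa L k ^+ 2 * (gw tau z (kappa L k) ^+ 2 *
      vsq (trunc u (S n) k)) = \sum_(k <- S n) kappa L k ^+ 2 *
      (gw tau z (kappa L k) ^+ 2 * vsq (u k)).
    by rewrite big_seq [RHS]big_seq; apply: eq_bigr => k kS; rewrite /trunc kS.
  have p : 0 <= \sum_(k <- S n) kappa L k ^+ 2 * (gw tau z (kappa L k) ^+ 2 * vsq (u k)).
    by apply: sumr_ge0 => k _; rewrite mulr_ge0 ?sqr_ge0 // mulr_ge0 ?sqr_ge0 ?vsq_ge0.
  by rewrite e lerXn2r ?nnegrE ?uK // (le_trans p) ?uK.
have hx1 : \sum_(j <- F) gw tau z (kappa L j) ^+ 2 *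
    (kappa L j ^- 2 * vsq ((x - b) j)) <= z ^- 2 * (z / 2) ^+ 2.
  apply: le_trans (ler_wpM2l _ hx); last by rewrite invr_ge0 sqr_ge0.
  rewrite mulr_sumr; apply: ler_sum => j _; apply: ler_wpM2r.
    by rewrite mulr_ge0 ?vsq_ge0 // invr_ge0 sqr_ge0.
  have g0 := ltW (gw_gt0 tau (kappa L j) z0).
  have z1 : 0 <= z^-1 by rewrite invr_ge0 ltW.
  by rewrite -exprVn lerXn2r ?nnegrE //; exact: gw_le_inv.
have e : z ^- 2 * (z / 2) ^+ 2 = 4^-1 by field; rewrite gt_eqF.
apply: (@le_trans _ _ (2 * (243 * (eta * K ^+ 2)) + 2 * 4^-1)); last by lra.
rewrite -e; apply: le_trans (lerD (ler_wpM2l _ hx2) (ler_wpM2l _ hx1)) => //.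
rewrite !mulr_sumr -big_split /=; apply: ler_sum => j _.
have -> : b j = x j - (x - b) j.
  by rewrite -[(x - b) j]/(x j - b j) opprB addrC subrK.
have gk : 0 <= gw tau z (kappa L j) ^+ 2 * kappa L j ^- 2.
  by rewrite mulr_ge0 ?sqr_ge0 // invr_ge0 sqr_ge0.
by have := ler_wpM2l gk (vsqB_le (x j) ((x - b) j)); lra.
Qed.

End Operators.

(** * The solution space and time derivatives *)

Section SpaceV.
Local Open Scope complex_scope.
Variables (R : realType) (L : R).
Hypothesis L0 : 0 < L.
Implicit Types (u v w : vfield R) (j k : freq) (s : seq freq).

Lemma L2norm_le_H1norm w : (L2norm w <= H1norm L w)%E.
Proof.
rewrite /H1norm -[leLHS]gee0_abs ?L2norm_ge0 // -sqrte_sqr.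
have h : (0 <= \sum_(a < 3) L2norm (partial L a w) ^+ 2)%E.
  by apply: sume_ge0 => a _; exact: sqre_ge0.
by rewrite lee_sqrt ?leeDl // adde_ge0 // sqre_ge0.
Qed.

(** Zero mean, reality and zero divergence are closed conditions on finitely many coefficients at a
    time, so this pointwise closeness is enough to pass them from trigonometric polynomials to V. *)
Lemma spaceV_approx u : spaceV L u -> forall eps, 0 < eps ->
  exists2 w, trig_poly L w & forall j, vsq (u j - w j) <= eps.
Proof.
move=> uV eps eps0.
have s0 : 0 < Num.sqrt eps by rewrite sqrtr_gt0.
have [w tw uw] := uV _ s0; exists w => // j.
have := le_trans (L2norm_le_H1norm _) (ltW uw).
move=> /(L2norm_leP _ (ltW s0)) /(_ [:: j] isT).
by rewrite big_seq1 sqr_sqrtr // ltW.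
Qed.

Lemma spaceV_mean_zero u : spaceV L u -> mean_zero u.
Proof.
move=> uV; apply: vsq_eq0 => eps eps0.
have [w [_ _ _ w0] /(_ 0)] := spaceV_approx uV eps0.
by rewrite w0 subr0.
Qed.

Lemma spaceV_real u : spaceV L u -> real_field u.
Proof.
move=> uV j a; apply/eqP; rewrite -subr_eq0; apply/eqP.
pose cj (z : cvec R) : cvec R := map_mx conjc z.
have vcj z : vsq (cj z) = vsq z.
  by apply: eq_bigr => b _; rewrite mxE; case: (z 0 b) => x y /=; rewrite sqrrN.
suff : u (- j) - cj (u j) = 0 by move=> /rowP /(_ a); rewrite !mxE.
apply: vsq_eq0 => eps eps0.
have e4 : 0 < eps / 4 by rewrite divr_gt0.
have [w [_ rw _ _] h] := spaceV_approx uV e4.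
have -> : u (- j) - cj (u j) = (u (- j) - w (- j)) - cj (u j - w j).
  by apply/rowP => b; rewrite !mxE rw rmorphB /= opprB addrA subrK.
apply: le_trans (vsqB_le _ _) _; rewrite vcj.
have := h j; have := h (- j); lra.
Qed.

Lemma spaceV_div_free u : spaceV L u -> div_free L u.
Proof.
move=> uV j.
have s3 w : normc (divergence L w j) <= 3 * (kappa L j * Num.sqrt (vsq (w j))).
  rewrite /divergence; apply: le_trans (normc_sum _ _ _) _.
  have -> : 3 = \sum_(a < 3) (1 : R) by rewrite sumr_const card_ord.
  rewrite mulr_suml; apply: ler_sum => a _; rewrite mul1r /partial mxE.
  rewrite !ComplexField.Normc.normcM; apply: ler_pM; rewrite ?vsq_ge_normc ?normc_ge0 //.
    by rewrite mulr_ge0 ?normc_ge0.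
  rewrite normc_real /= expr0n add0r expr1n sqrtr1 mul1r.
  exact: abs_freq_le_kappa.
apply: ComplexField.Normc.eq0_normc; apply/le_anti; rewrite normc_ge0 andbT.
apply/ler_addgt0Pr => e e0; rewrite add0r.
pose del := e / (3 * (kappa L j + 1)).
have k0 := kappa_ge0 L0 j.
have del0 : 0 < del by rewrite divr_gt0 // mulr_gt0 //; lra.
have [w [_ _ dw _] h] := spaceV_approx uV (exprn_gt0 2 del0).
have -> : divergence L u j = divergence L (u - w) j.
  rewrite -[LHS]subr0 -(dw j) /divergence -sumrB; apply: eq_bigr => a _.
  by rewrite /partial !mxE mulrBr.
apply: le_trans (s3 _) _.
have hs : Num.sqrt (vsq ((u - w) j)) <= del.
  rewrite -(ger0_norm (ltW del0)) -sqrtr_sqr ler_sqrt ?sqr_ge0 //; exact: h.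
have e1 : e = 3 * ((kappa L j + 1) * del) by rewrite /del; field; lra.
rewrite e1 ler_wpM2l // ler_pM // ?sqrtr_ge0 //; lra.
Qed.

End SpaceV.

Lemma is_derive_eps (R : realType) (f : R -> R) (t l : R) :
  (forall e, 0 < e -> exists2 eta, 0 < eta & forall h, h != 0 -> `|h| < eta ->
     `|h^-1 * (f (t + h) - f t) - l| <= e) -> is_derive t 1 f l.
Proof.
move=> H.
have c : h^-1 *: ((f \o shift t) (h *: 1) - f t) @[h --> 0^'] --> l.
  apply/cvgrPdist_le => e e0; have [eta eta0 he] := H e e0.
  exists eta => //= h /=; rewrite sub0r normrN => hn h0.
  by rewrite distrC [h *: 1]mulr1 /= [h + t]addrC; exact: he.
by split; [apply/cvg_ex; exists l|exact/cvg_lim].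
Qed.

Lemma is_derive_sum_seq (R : realType) (I : Type) (r : seq I) (f : I -> R -> R)
    (df : I -> R) (t : R) :
  (forall i, is_derive t 1 (f i) (df i)) ->
  is_derive t 1 (fun x => \sum_(i <- r) f i x) (\sum_(i <- r) df i).
Proof.
move=> H; elim: r => [|i r IH].
  rewrite big_nil (_ : (fun _ => _) = cst 0); first exact: is_derive_cst.
  by apply/funext => x; rewrite big_nil.
rewrite big_cons.
rewrite (_ : (fun _ => _) = f i + (fun x => \sum_(i <- r) f i x)).
  exact: is_deriveD.
by apply/funext => x; rewrite big_cons.
Qed.

Lemma is_derive_vsq (R : realType) (u : R -> cvec R) (du : cvec R) (t : R) :
  (forall a, is_derive t 1 (fun x => complex.Re (u x 0 a)) (complex.Re (du 0 a))) ->
  (forall a, is_derive t 1 (fun x => complex.Im (u x 0 a)) (complex.Im (du 0 a))) ->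
  is_derive t 1 (fun x => vsq (u x)) (2 * dotr (u t) du).
Proof.
move=> dRe dIm; rewrite /dotr mulr_sumr.
apply: is_derive_sum_seq => a.
have h1 := dRe a; have h2 := dIm a.
have h := is_deriveD (is_deriveM h1 h1) (is_deriveM h2 h2).
apply: (is_derive_eq h).
rewrite /GRing.scale /=; ring.
Qed.

Lemma cvg_sum_seq (R : realType) (T I : Type) (F : set_system T) (r : seq I)
    (f : I -> T -> R) (l : I -> R) : Filter F ->
  (forall i, f i t @[t --> F] --> l i) ->
  \sum_(i <- r) f i t @[t --> F] --> \sum_(i <- r) l i.
Proof.
move=> FF H; elim: r => [|i r IH].
  rewrite big_nil (_ : (fun _ => _) = cst 0); first exact: cvg_cst.
  by apply/funext => x; rewrite big_nil.
rewrite big_cons.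
rewrite (_ : (fun _ => _) = f i \+ (fun x => \sum_(i <- r) f i x)).
  exact: cvgD.
by apply/funext => x; rewrite big_cons.
Qed.

Lemma vsq_continuous (R : realType) (x : cvec R) (e : R) : 0 < e ->
  exists2 del, 0 < del & forall y, vsq (y - x) <= del -> `|vsq y - vsq x| <= e.
Proof.
move=> e0; have x0 := vsq_ge0 x.
(* Parameter for Young's inequality on the cross term: the share of [vsq x] stays below e / 2, and
   the radius chosen below absorbs the rest. *)
pose th := e / (2 * (vsq x + 1)).
have th0 : 0 < th by rewrite divr_gt0 // mulr_gt0 //; lra.
have ti0 : 0 < th^-1 + 1 by rewrite addr_gt0 // invr_gt0.
exists (e / 2 / (th^-1 + 1)) => [|y]; first by rewrite !divr_gt0.
rewrite ler_pdivlMr // => h.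
have -> : y = x + (y - x) by rewrite addrC subrK.
have h1 := dotr_young x (y - x) th0.
have h2 := dotr_young x (- (y - x)) th0.
have dN : dotr x (- (y - x)) = - dotr x (y - x).
  have := dotrZr (-1) x (y - x).
  by rewrite rmorphN1 scaleN1r mulN1r.
rewrite dN vsqN in h2; rewrite vsqD; have w0 := vsq_ge0 (y - x).
have hx : th * vsq x <= e / 2.
  have -> : e / 2 = th * (vsq x + 1) by rewrite /th; field; lra.
  by rewrite ler_pM2l //; lra.
rewrite ler_norml; apply/andP; split; lra.
Qed.

Section VDerivative.
Local Open Scope complex_scope.
Variables (R : realType) (L : R).
Hypothesis L0 : 0 < L.
Implicit Types (j k : freq) (s : seq freq).

Lemma V_derivative_eps (u : R -> vfield R) t du e :
  V_derivative L u t du -> 0 < e ->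
  exists2 eta, 0 < eta & forall h, h != 0 -> `|h| < eta -> 0 <= t + h ->
    forall s, uniq s ->
    \sum_(j <- s) kappa L j ^+ 2 *
       vsq ((h^-1)%:C *: (u (t + h) j - u t j) - du j) <= e ^+ 2.
Proof.
move=> /nbhs0_cvgeP -/(_ (fun _ => Vnorm_ge0 _ _ _)) ud e0.
have [eta eta0 H] := ud e e0.
exists eta => //= h h0 he th s us.
have := H h _ h0 th; rewrite /= sub0r normrN => /(_ he).
by move=> /(Vnorm1_leP L0 _ (ltW e0)) /(_ s us).
Qed.

Lemma V_derivative_coord (u : R -> vfield R) t du j e : j != 0 ->
  V_derivative L u t du -> 0 < e ->
  exists2 eta, 0 < eta & forall h, h != 0 -> `|h| < eta -> 0 <= t + h ->
    vsq ((h^-1)%:C *: (u (t + h) j - u t j) - du j) <= e.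
Proof.
move=> j0 ud e0; have k0 := kappa_gt0 L0 j0.
have e'0 : 0 < kappa L j * Num.sqrt e by rewrite mulr_gt0 // sqrtr_gt0.
have [eta eta0 H] := V_derivative_eps ud e'0.
exists eta => // h h0 he th; have := H h h0 he th [:: j] isT.
rewrite big_seq1 [X in _ <= X]exprMn (sqr_sqrtr (ltW e0)).
by rewrite ler_pM2l // exprn_gt0.
Qed.

Lemma V_derivative_is_derive (u : R -> vfield R) t du j : j != 0 -> 0 < t ->
  V_derivative L u t du ->
  is_derive t 1 (fun x => vsq (u x j)) (2 * dotr (u t j) (du j)).
Proof.
move=> j0 t0 ud.
have H e : 0 < e -> exists2 eta, 0 < eta & forall h, h != 0 -> `|h| < eta ->
    vsq ((h^-1)%:C *: (u (t + h) j - u t j) - du j) <= e ^+ 2.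
  move=> e0; have [eta eta0 he] := V_derivative_coord j0 ud (exprn_gt0 2 e0).
  (* Steps shorter than t keep t + h nonnegative, so the derivative relative to the half-line is
     two-sided. *)
  exists (Num.min eta t); first by rewrite lt_min eta0.
  move=> h h0; rewrite lt_min => /andP[h1 h2]; apply: he => //.
  by have := ler_norm (- h); rewrite normrN; lra.
apply: is_derive_vsq => a; apply: is_derive_eps => e e0;
  have [eta eta0 he] := H e e0; exists eta => // h h0 h1;
  rewrite -(@ler_pXn2r _ 2%N) ?nnegrE ?(ltW e0) // real_normK ?num_real //;
  apply: le_trans (he h h0 h1).
- apply: le_trans (vsq_ge_Re _ a); rewrite !mxE.
  by case: (u (t + h) j 0 a) (u t j 0 a) (du j 0 a) => [x y] [x' y'] [x2 y2] /=;
    rewrite mul0r subr0.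
- apply: le_trans (vsq_ge_Im _ a); rewrite !mxE.
  by case: (u (t + h) j 0 a) (u t j 0 a) (du j 0 a) => [x y] [x' y'] [x2 y2] /=;
    rewrite mul0r addr0.
Qed.

Lemma V_derivative_continuous (u : R -> vfield R) t du j : j != 0 ->
  V_derivative L u t du -> forall del, 0 < del ->
  exists2 eta, 0 < eta & forall x, 0 <= x -> `|x - t| < eta ->
    vsq (u x j - u t j) <= del.
Proof.
move=> j0 ud del del0.
have [eta eta0 H] := V_derivative_coord j0 ud (@ltr01 R).
pose C := 2 + 2 * vsq (du j).
have C0 : 0 < C by have := vsq_ge0 (du j); rewrite /C; lra.
exists (Num.min eta (Num.sqrt (del / C))).
  by rewrite lt_min eta0 sqrtr_gt0 divr_gt0.
move=> x x0; rewrite lt_min => /andP[h1 h2].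
have [->|xt] := eqVneq x t; first by rewrite subrr vsq0 ltW.
have h0 : x - t != 0 by rewrite subr_eq0.
have := H _ h0 h1; rewrite [t + _]addrC subrK => /(_ x0).
set D := _ *: _; move=> hD.
have -> : u x j - u t j = (x - t)%:C *: D.
  by rewrite /D scalerA -rmorphM mulfV // rmorph1 scale1r.
rewrite vsqZ.
have hD2 : vsq D <= C.
  have -> : D = (D - du j) + du j by rewrite subrK.
  by apply: le_trans (vsqD_le _ _) _; rewrite /C; lra.
have hx : (x - t) ^+ 2 <= del / C.
  rewrite -[(x - t) ^+ 2]real_normK ?num_real //.
  rewrite -[leRHS]sqr_sqrtr ?divr_ge0 ?(ltW C0) ?(ltW del0) //.
  by rewrite lerXn2r ?nnegrE ?sqrtr_ge0 // ltW.
apply: le_trans (ler_pM (sqr_ge0 _) (vsq_ge0 _) hx hD2) _.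
by rewrite divfK ?gt_eqF.
Qed.

Lemma V_derivative_vsq_cvg (u : R -> vfield R) t du j (A : set R) : j != 0 ->
  V_derivative L u t du -> (forall x, A x -> 0 <= x) ->
  vsq (u x j) @[x --> within A (nbhs t)] --> vsq (u t j).
Proof.
move=> j0 ud A0; apply/cvgrPdist_le => e e0.
have [del del0 H] := vsq_continuous (u t j) e0.
have [eta eta0 H'] := V_derivative_continuous j0 ud del0.
exists eta => //= x; rewrite /ball_ /= distrC => xt Ax.
by rewrite distrC; apply: H; apply: H' => //; exact: A0.
Qed.

(** The continuity argument needs right continuity in V uniformly over finite frequency sets, which
    mode-by-mode continuity does not give. The V norm of [du] is bounded through the single
    difference quotient of step [h1], itself controlled by M. *)
Lemma V_derivative_lipschitz (u : R -> vfield R) t du (M : R) :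
  0 <= t -> 0 <= M -> V_derivative L u t du ->
  (forall x, t <= x -> (Vnorm L 1 (u x) <= M%:E)%E) ->
  exists C, 0 < C /\ exists2 eta, 0 < eta & forall x, t <= x < t + eta ->
    forall s, uniq s ->
    \sum_(j <- s) kappa L j ^+ 2 * vsq (u x j - u t j) <= C * (x - t) ^+ 2.
Proof.
move=> t0 M0 ud uM.
have [eta eta0 H] := V_derivative_eps ud ltr01.
pose h1 := eta / 2.
have h10 : 0 < h1 by rewrite divr_gt0.
have h1n : h1 != 0 by rewrite gt_eqF.
have h1e : `|h1| < eta by rewrite ger0_norm ?ltW // /h1; lra.
have uM2 x s : t <= x -> uniq s -> \sum_(j <- s) kappa L j ^+ 2 * vsq (u x j) <= M ^+ 2.
  by move=> tx; move: s; apply/(Vnorm1_leP L0 _ M0); exact: uM.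
have sum2 (a b : freq -> cvec R) s : \sum_(j <- s) kappa L j ^+ 2 * vsq (a j - b j) <=
    2 * (\sum_(j <- s) kappa L j ^+ 2 * vsq (a j)) +
    2 * (\sum_(j <- s) kappa L j ^+ 2 * vsq (b j)).
  rewrite !mulr_sumr -big_split /=; apply: ler_sum => j _.
  by have := ler_wpM2l (sqr_ge0 (kappa L j)) (vsqB_le (a j) (b j)); lra.
pose D1 (j : freq) := (h1^-1)%:C *: (u (t + h1) j - u t j).
pose C1 := h1^-1 ^+ 2 * (4 * M ^+ 2).
have D1C s : uniq s -> \sum_(j <- s) kappa L j ^+ 2 * vsq (D1 j) <= C1.
  move=> us; rewrite /D1; under eq_bigr do rewrite vsqZ mulrCA.
  rewrite -mulr_sumr ler_wpM2l ?sqr_ge0 //.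
  apply: le_trans (sum2 _ _ _) _.
  have := uM2 t s (lexx _) us.
  by have := uM2 (t + h1) s _ us; rewrite lerDl => /(_ (ltW h10)); lra.
pose C2 := 2 * C1 + 2.
have duC s : uniq s -> \sum_(j <- s) kappa L j ^+ 2 * vsq (du j) <= C2.
  move=> us; have e j : du j = D1 j - (D1 j - du j) by rewrite subKr.
  under eq_bigr do rewrite e.
  apply: le_trans (sum2 D1 (fun j => D1 j - du j) s) _.
  have := H h1 h1n h1e _ s us; rewrite expr1n => /(_ (addr_ge0 t0 (ltW h10))).
  by rewrite -/D1 => ?; have := D1C s us; rewrite /C2; lra.
have C10 : 0 <= C1 by rewrite mulr_ge0 ?sqr_ge0 // mulr_ge0 ?sqr_ge0.
exists (2 + 2 * C2); split; first by rewrite /C2; lra.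
exists eta => // x /andP[tx xe] s us.
have [->|xt] := eqVneq x t.
  by rewrite subrr expr0n mulr0 big1 // => j _; rewrite subrr vsq0 mulr0.
have h0 : x - t != 0 by rewrite subr_eq0.
have := H (x - t) h0 _ _ s us; rewrite ger0_norm ?subr_ge0 // [t + _]addrC subrK.
move=> /(_ _ (le_trans t0 tx)); rewrite expr1n => hD.
have {}hD := hD _.
have {}hD : \sum_(j <- s) kappa L j ^+ 2 *
    vsq ((x - t)^-1%:C *: (u x j - u t j) - du j) <= 1.
  by apply: hD; lra.
have e j : u x j - u t j =
    (x - t)%:C *: (((x - t)^-1%:C *: (u x j - u t j) - du j) - (- du j)).
  by rewrite opprK subrK scalerA -rmorphM mulfV // rmorph1 scale1r.
under eq_bigr do rewrite e vsqZ mulrCA.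
rewrite -mulr_sumr mulrC ler_wpM2r ?sqr_ge0 //.
apply: le_trans (sum2 (fun j => (x - t)^-1%:C *: (u x j - u t j) - du j)
  (fun j => - du j) s) _.
under [X in _ + 2 * X]eq_bigr do rewrite vsqN.
have := duC s us; lra.
Qed.

End VDerivative.

(** * The energy estimate *)

Section Energy.
Local Open Scope complex_scope.
Variables (R : realType) (L nu alpha : R).
Hypotheses (L0 : 0 < L) (nu0 : 0 < nu) (alpha0 : 0 < alpha).

(* The infimum over the spectrum of nu k^2 / (1 + alpha^2 k^2). *)
Definition damping : R := nu * lambda1 L / (1 + alpha ^+ 2 * lambda1 L).

Lemma damping_gt0 : 0 < damping.
Proof.
have l0 := lambda1_gt0 L0.
by apply: divr_gt0; [exact: mulr_gt0|apply/addr_gt0/mulr_gt0/l0/exprn_gt0].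
Qed.

(** Pairing the equation with x gives m (x, y) = (x, f - b) - nu k^2 |x|^2 with m = 1 + alpha^2 k^2
    and nu k^2 >= d m, where d is [damping]. Young's inequality spends d / 2 of the rate 2 d; of the
    remaining 3 d / 2, another d / 2 is reserved for the growth of the weight. *)
Lemma mode_dissipation (k : R) (x y f b : cvec R) : 0 < k ->
  lambda1 L <= k ^+ 2 ->
  y + nu%:C *: ((k ^+ 2)%:C *: x) + (alpha ^+ 2)%:C *: ((k ^+ 2)%:C *: y) + b = f ->
  k ^+ 2 * (2 * dotr x y) <= - (3 / 2 * damping) * (k ^+ 2 * vsq x) +
    4 / damping * (k ^+ 2 * vsq f + alpha ^- 4 * (k ^- 2 * vsq b)).
Proof.
move=> k0 lk; have l0 := lambda1_gt0 L0; have d0 := damping_gt0.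
rewrite !scalerA -!rmorphM => e.
have a20 : 0 < alpha ^+ 2 by rewrite exprn_gt0.
have k20 : 0 < k ^+ 2 by rewrite exprn_gt0.
pose m := 1 + alpha ^+ 2 * k ^+ 2.
have m0 : 0 < m by exact/addr_gt0/mulr_gt0.
have dm : damping * m <= nu * k ^+ 2.
  rewrite /damping mulrAC ler_pdivrMr; last exact/addr_gt0/mulr_gt0.
  by have := ler_wpM2l (ltW nu0) lk; rewrite /m; lra.
have e1 : m * dotr x y = dotr x (f - b) - nu * k ^+ 2 * vsq x.
  have -> : f - b = y + (nu * k ^+ 2)%:C *: x + (alpha ^+ 2 * k ^+ 2)%:C *: y.
    by rewrite -e addrK.
  by rewrite !dotrDr !dotrZr dotrr /m; ring.
have c0 : 0 < damping * m / 2 by rewrite divr_gt0 // mulr_gt0.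
have h1 := dotr_young x (f - b) c0.
have h2 := vsqB_le f b.
have x0 := vsq_ge0 x.
have i0 : 0 < (damping * m / 2)^-1 by rewrite invr_gt0.
have h3 : m * (2 * dotr x y) <= - (3 / 2 * damping) * m * vsq x +
    (damping * m / 2)^-1 * (2 * vsq f + 2 * vsq b).
  have := ler_wpM2l (ltW i0) h2; have := ler_wpM2r x0 dm; lra.
have h4 : 2 * dotr x y <= - (3 / 2 * damping) * vsq x +
    4 / damping * (m ^- 2 * (vsq f + vsq b)).
  rewrite -(ler_pM2l m0); apply: le_trans h3 _.
  rewrite le_eqVlt; apply/orP; left; apply/eqP; field.
  by rewrite !gt_eqF.
apply: le_trans (ler_wpM2l (ltW k20) h4) _.
have dd : 0 < 4 / damping by rewrite divr_gt0.
(* The forcing uses only m >= 1. For b, both powers of m are traded for alpha^2 k^2, which turns k^2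
   into k^-2: this is the smoothing that makes the V' norm of b suffice. *)
have h5 : k ^+ 2 * (m ^- 2 * (vsq f + vsq b)) <=
    k ^+ 2 * vsq f + alpha ^- 4 * (k ^- 2 * vsq b).
  have f0 := vsq_ge0 f; have b0 := vsq_ge0 b.
  have m1 : m ^- 2 <= 1.
    rewrite invf_le1 ?exprn_gt0 // exprn_ege1 // /m lerDl.
    by rewrite mulr_ge0 // ltW.
  have m2 : k ^+ 2 * m ^- 2 <= alpha ^- 4 * k ^- 2.
    have -> : alpha ^- 4 * k ^- 2 = k ^+ 2 * (alpha ^+ 2 * k ^+ 2) ^- 2.
      by field; rewrite !gt_eqF.
    rewrite ler_pM2l // lef_pV2 ?posrE ?exprn_gt0 // ?mulr_gt0 //.
    by rewrite lerXn2r ?nnegrE ?(ltW m0) ?mulr_ge0 ?ltW // /m ltrDr.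
  rewrite mulrDr mulrDr; apply: lerD.
    by rewrite ler_pM2l // ler_piMl.
  by rewrite !mulrA ler_wpM2r.
have := ler_wpM2l (ltW dd) h5; lra.
Qed.

End Energy.

Lemma is_derive_expR_affine (R : realType) (del t0 t : R) :
  is_derive t 1 (fun x => expR (- (del * (x - t0))))
    (- (del * expR (- (del * (t - t0))))).
Proof.
have h : is_derive t 1 (fun x => - (del * (x - t0))) (- del).
  have h0 : is_derive t 1 (fun x => x - t0) 1.
    by apply: is_derive_eq; rewrite subr0.
  have h1 := is_deriveN (is_deriveZ del h0).
  by apply: (is_derive_eq h1); rewrite /GRing.scale /= mulr1.
apply: (is_derive_eq (is_derive1_comp (is_derive_expR _) h)).
by rewrite mulrN mulrC.
Qed.

Lemma is_derive_gw (R : realType) (tau del t0 k t : R) :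
  is_derive t 1 (fun x => gw tau (expR (- (del * (x - t0)))) k)
    (del * expR (- (del * (t - t0))) * gw tau (expR (- (del * (t - t0)))) k ^+ 2).
Proof.
rewrite /gw.
have h1 := is_deriveD (is_derive_cst (expR (- (tau * k))) t 1)
  (is_derive_expR_affine del t0 t).
have n0 : expR (- (tau * k)) + expR (- (del * (t - t0))) != 0.
  by rewrite gt_eqF // addr_gt0 ?expR_gt0.
have h2 := @is_deriveV _ (cst (expR (- (tau * k))) +
  (fun x => expR (- (del * (x - t0))))) t _ 1 n0 h1.
rewrite (_ : (fun _ => _) = (fun y => ((cst (expR (- (tau * k))) +
  (fun x => expR (- (del * (x - t0))))) y)^-1)); last by apply/funext.
refine (is_derive_eq h2 _).
rewrite /GRing.scale /= add0r exprVn mulNr mulrN opprK mulrC; congr (_ * _).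
Qed.

(** * The uniform bound in the weighted norm *)

Section GevreyBound.
Local Open Scope complex_scope.
Variables (R : realType) (L nu alpha tau tau0 rho eta F M t0 : R).
Variables (f : vfield R) (u ut : R -> vfield R).
Hypotheses (L0 : 0 < L) (nu0 : 0 < nu) (alpha0 : 0 < alpha).
Hypotheses (tau_ge0 : 0 <= tau) (tau_le : tau <= tau0) (rho0 : 0 <= rho).
Hypotheses (tau_rho : tau * rho <= 1) (eta0 : 0 <= eta) (M0 : 0 <= M) (t00 : 0 <= t0).
Hypothesis high_tail : forall s : seq freq, uniq s ->
  (forall j, j \in s -> rho < kappa L j) ->
  forall i, \sum_(j <- s) kappa L j ^- 2 * kappa L (j - i) ^- 2 <= eta.
Hypothesis fF : forall s : seq freq, uniq s ->
  \sum_(j <- s) (kappa L j * expR (tau0 * kappa L j)) ^+ 2 * vsq (f j) <= F ^+ 2.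
Hypothesis sol : forall t, 0 <= t ->
    [/\ spaceV L (u t), spaceV L (ut t), V_derivative L u t (ut t) &
        exists2 b, B_ext L (u t) (u t) b &
          ut t + nu%:C *: stokes L (u t) + (alpha ^+ 2)%:C *: stokes L (ut t) + b
          = f].
Hypothesis uM : forall t, t0 <= t -> (Vnorm L 1 (u t) <= M%:E)%E.

Let d := damping L nu alpha.
(** The level at which the damping balances the sources: d H is 4 / d times F^2 + 2 alpha^-4, the 2
    being a bound for 486 eta K^2 + 1. *)
Let H := 4 / d ^+ 2 * (F ^+ 2 + 2 * alpha ^- 4).
(* The factor 8 leaves the room needed to carry a bound valid at time T a
   little beyond T. *)
Definition trap_level := 8 * (expR 1 ^+ 2 * M ^+ 2 + M ^+ 2 + H) + 8.
Let K := trap_level.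
Hypothesis eta_small : 486 * (eta * K ^+ 2) <= 1.
Let z t := expR (- (d / 4 * (t - t0))).
Let W t j := gw tau (z t) (kappa L j).
Let bounded_at C t := forall s : seq freq, uniq s ->
  \sum_(j <- s) kappa L j ^+ 2 * (W t j ^+ 2 * vsq (u t j)) <= C.

Let d0 : 0 < d. Proof. exact: damping_gt0. Qed.

Let z_gt0 t : 0 < z t. Proof. exact: expR_gt0. Qed.

Let z_le1 t : t0 <= t -> z t <= 1.
Proof.
by move=> tt; rewrite -expR0 ler_expR oppr_le0 mulr_ge0 ?subr_ge0 // divr_ge0 // ltW.
Qed.

Let W_gt0 t j : 0 < W t j. Proof. exact: gw_gt0. Qed.

Let H_ge0 : 0 <= H.
Proof.
rewrite mulr_ge0 ?divr_ge0 ?sqr_ge0 // addr_ge0 ?sqr_ge0 // mulr_ge0 //.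
by rewrite invr_ge0 exprn_ge0 // ltW.
Qed.

Lemma trap_level_ge8 : 8 <= trap_level.
Proof.
by rewrite lerDr mulr_ge0 // addr_ge0 // addr_ge0 ?sqr_ge0 // mulr_ge0 ?sqr_ge0.
Qed.

Let V_le s t : t0 <= t -> uniq s ->
  \sum_(j <- s) kappa L j ^+ 2 * vsq (u t j) <= M ^+ 2.
Proof.
by move=> tt; move: s; apply/(Vnorm1_leP L0 _ M0); exact: uM.
Qed.

Let dE t j := (2 * W t j * (d / 4 * z t * W t j ^+ 2)) * vsq (u t j) +
  W t j ^+ 2 * (2 * dotr (u t j) (ut t j)).

(** The growth of the weight adds (d / 2) (z W) times the weighted energy of the mode, and z W <= 1;
    this lowers the rate 3 d / 2 to d. *)
Let mode_le t j b : 0 <= t -> t0 <= t -> j != 0 ->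
  ut t + nu%:C *: stokes L (u t) + (alpha ^+ 2)%:C *: stokes L (ut t) + b = f ->
  kappa L j ^+ 2 * dE t j <= - d * (kappa L j ^+ 2 * (W t j ^+ 2 * vsq (u t j))) +
    4 / d * (kappa L j ^+ 2 * (W t j ^+ 2 * vsq (f j)) +
             alpha ^- 4 * (W t j ^+ 2 * (kappa L j ^- 2 * vsq (b j)))).
Proof.
move=> t_ge0 tt j0 /(congr1 (fun g : vfield R => g j)) e.
have [uV utV _ _] := sol t_ge0.
have e' : ut t j + nu%:C *: stokes L (u t) j + (alpha ^+ 2)%:C *: stokes L (ut t) j +
   b j = f j by exact: e.
rewrite (stokesE L0 j (spaceV_div_free L0 uV) (spaceV_mean_zero uV)) in e'.
rewrite (stokesE L0 j (spaceV_div_free L0 utV) (spaceV_mean_zero utV)) in e'.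
have := mode_dissipation L0 nu0 alpha0 (kappa_gt0 L0 j0) (kappa_sqr_ge L0 j0) e'.
rewrite -/d => h.
have W2 : 0 <= W t j ^+ 2 by exact: sqr_ge0.
have zW : z t * W t j <= 1.
  by rewrite mulrC -ler_pdivlMr ?z_gt0 // div1r gw_le_inv.
have p : 0 <= d / 4 * (W t j ^+ 2 * (kappa L j ^+ 2 * vsq (u t j))).
  apply: mulr_ge0; first by rewrite divr_ge0 // ltW.
  by apply: mulr_ge0 => //; apply: mulr_ge0; [exact: sqr_ge0|exact: vsq_ge0].
have h1 := ler_wpM2l p zW; have h2 := ler_wpM2l W2 h.
rewrite /dE.
move: h1 h2; move: (z t) (W t j) (kappa L j) (vsq (u t j)) (dotr _ _) (vsq (b j))
  (vsq (f j)).
move: d => d' z' w k x y vb vf h1 h2.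
suff -> : k ^+ 2 * (2 * w * (d' / 4 * z' * w ^+ 2) * x + w ^+ 2 * (2 * y)) =
  2 * (d' / 4 * (w ^+ 2 * (k ^+ 2 * x)) * (z' * w)) + w ^+ 2 * (k ^+ 2 * (2 * y)).
  lra.
ring.
Qed.

(** The level K enters only through the quadratic term, which [eta_small] caps by a constant, so the
    resulting bound is free of K. Initially z = 1, hence the weight is at most 1 and the V bound is
    enough. *)
Let high_energy T s : t0 <= T ->
  (forall t, t0 <= t < T -> bounded_at K t) -> uniq s ->
  (forall j, j \in s -> rho < kappa L j) ->
  \sum_(j <- s) kappa L j ^+ 2 * (W T j ^+ 2 * vsq (u T j)) <= M ^+ 2 + H.
Proof.
move=> tT bT us hs.
have sn0 j : j \in s -> j != 0.
  move=> /hs; apply: contraTneq => ->; rewrite kappa0 -leNgt //.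
pose E t := \sum_(j <- s) kappa L j ^+ 2 * (W t j ^+ 2 * vsq (u t j)).
have E0 : 0 <= E t0.
  by apply: sumr_ge0 => j _; rewrite mulr_ge0 ?sqr_ge0 // mulr_ge0 ?sqr_ge0 ?vsq_ge0.
have Et0 : E t0 <= M ^+ 2.
  apply: le_trans (V_le (lexx t0) us); apply: ler_sum => j _.
  rewrite ler_wpM2l ?sqr_ge0 // ler_piMl ?vsq_ge0 // expr_le1 //.
    apply: le_trans (gw_le_inv _ _ (z_gt0 t0)) _.
    by rewrite /z subrr mulr0 oppr0 expR0 invr1.
  exact: ltW.
apply: (@le_trans _ _ (E t0 + H)); last by rewrite lerD2r.
rewrite -/(E T).
(* The rules for sums ask every index to be differentiable, but the V norm says nothing about j = 0;
   that index, absent from s, is given the value 0. *)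
have Es t : E t = \sum_(j <- s) (if j == 0 then 0 else
    kappa L j ^+ 2 * (W t j ^+ 2 * vsq (u t j))).
  by rewrite /E big_seq [RHS]big_seq; apply: eq_bigr => j /sn0 /negPf ->.
have dEs t : \sum_(j <- s) kappa L j ^+ 2 * dE t j = \sum_(j <- s) (if j == 0 then 0 else
    kappa L j ^+ 2 * dE t j).
  by rewrite big_seq [RHS]big_seq; apply: eq_bigr => j /sn0 /negPf ->.
apply: (@gronwall_max R E (fun t => \sum_(j <- s) kappa L j ^+ 2 * dE t j)
  t0 T d H) => //.
- apply: (proj2 (subspace_continuousP _ _)) => t /= /[!in_itv] /= /andP[t0t tT'].
  have [_ _ ud _] := sol (le_trans t00 t0t).
  rewrite (funext Es).
  apply: cvg_sum_seq => j; case: eqVneq => [_|j0]; first exact: cvg_cst.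
  apply: cvgM; first exact: cvg_cst.
  apply: cvgM; last first.
    apply: (V_derivative_vsq_cvg L0 j0 ud) => x /= /[!in_itv] /= /andP[t0x _].
    exact: le_trans t0x.
  apply: cvg_within_filter.
  have hd := is_derive_gw tau (d / 4) t0 (kappa L j) t.
  have hc : {for t, continuous
      (fun x => gw tau (expR (- (d / 4 * (x - t0)))) (kappa L j))}.
    by apply/differentiable_continuous/derivable1_diffP; case: hd.
  by apply: cvgM; exact: hc.
- move=> t /[!in_itv] /= /andP[t0t tT'].
  have t_gt0 : 0 < t := le_lt_trans t00 t0t.
  have [_ _ ud _] := sol (ltW t_gt0).
  rewrite (funext Es).
  rewrite dEs; apply: is_derive_sum_seq => j; case: eqVneq => [_|j0].
    exact: is_derive_cst.
  have h1 := is_derive_gw tau (d / 4) t0 (kappa L j) t.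
  have h2 := V_derivative_is_derive L0 j0 t_gt0 ud.
  have h3 := is_deriveZ (kappa L j ^+ 2) (is_deriveM (is_deriveM h1 h1) h2).
  by apply: (is_derive_eq h3); rewrite /dE /W /z /GRing.scale mulrfctE /=; ring.
- move=> t /[!in_itv] /= /andP[t0t tT'].
  have t_ge0 : 0 <= t := le_trans t00 (ltW t0t).
  have [uV utV ud [b Bb eb]] := sol t_ge0.
  have zt : 0 < z t <= 1 by rewrite z_gt0 z_le1 // ltW.
  have bt : bounded_at K t by apply: bT; rewrite (ltW t0t).
  have hb := B_ext_weighted_le L0 tau_ge0 zt (spaceV_real uV) (spaceV_div_free L0 uV)
    (spaceV_mean_zero uV) M0 (uM (ltW t0t)) Bb us (high_tail us hs) eta0 bt.
  have hf : \sum_(j <- s) kappa L j ^+ 2 * (W t j ^+ 2 * vsq (f j)) <= F ^+ 2.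
    apply: le_trans (fF us); apply: ler_sum => j _; rewrite mulrA.
    apply: ler_wpM2r; first exact: vsq_ge0.
    rewrite -exprMn; have k0 := kappa_ge0 L0 j.
    have p1 := mulr_ge0 k0 (ltW (W_gt0 t j)).
    have p2 := mulr_ge0 k0 (expR_ge0 (tau0 * kappa L j)).
    rewrite lerXn2r ?nnegrE //; apply: ler_wpM2l => //.
    apply: le_trans (gw_le_exp _ _ (z_gt0 t)) _.
    by rewrite ler_expR ler_wpM2r.
  apply: (@le_trans _ _ (- d * E t + 4 / d * (F ^+ 2 + alpha ^- 4 * 2))); last first.
    rewrite /H; rewrite le_eqVlt; apply/orP; left; apply/eqP.
    by field; rewrite !gt_eqF.
  apply: (@le_trans _ _ (- d * E t + 4 / d * (
      \sum_(j <- s) kappa L j ^+ 2 * (W t j ^+ 2 * vsq (f j)) +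
      alpha ^- 4 * \sum_(j <- s) W t j ^+ 2 * (kappa L j ^- 2 * vsq (b j))))); last first.
    rewrite lerD2l; apply: ler_wpM2l; first by rewrite divr_ge0 // ltW.
    apply: lerD => //; apply: ler_wpM2l; first by rewrite invr_ge0 exprn_ge0 // ltW.
    apply: le_trans hb _; rewrite -/K; have := eta_small; lra.
  rewrite /E !mulr_sumr -big_split /= mulr_sumr -big_split /= big_seq [leRHS]big_seq.
  by apply: ler_sum => j /sn0 j0; exact: mode_le (ltW t0t) j0 eb.
Qed.

Let bounded_step T : t0 <= T ->
  (forall t, t0 <= t < T -> bounded_at K t) -> bounded_at (K / 8) T.
Proof.
move=> tT bT s us; rewrite (bigID (fun j => rho < kappa L j)) /= -big_filter.
rewrite -[X in _ + X]big_filter.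
have h1 : \sum_(j <- [seq j <- s | rho < kappa L j])
    kappa L j ^+ 2 * (W T j ^+ 2 * vsq (u T j)) <= M ^+ 2 + H.
  apply: high_energy => //; first exact: filter_uniq.
  by move=> j; rewrite mem_filter => /andP[].
have h2 : \sum_(j <- [seq j <- s | ~~ (rho < kappa L j)])
    kappa L j ^+ 2 * (W T j ^+ 2 * vsq (u T j)) <= expR 1 ^+ 2 * M ^+ 2.
  apply: le_trans (ler_wpM2l (sqr_ge0 _) (V_le tT (filter_uniq _ us))).
  rewrite mulr_sumr big_seq [leRHS]big_seq; apply: ler_sum => j.
  rewrite mem_filter -leNgt => /andP[kr _].
  rewrite [leRHS]mulrCA ler_wpM2l ?sqr_ge0 // ler_wpM2r ?vsq_ge0 //.
  rewrite lerXn2r ?nnegrE ?expR_ge0 ?(ltW (W_gt0 _ _)) //.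
  apply: le_trans (gw_le_exp _ _ (z_gt0 T)) _; rewrite ler_expR.
  by apply: le_trans tau_rho; rewrite ler_wpM2l.
apply: le_trans (lerD h1 h2) _; rewrite /K /trap_level; lra.
Qed.

(** The increment u(t) - u(T) is small only in V, so it is paid for with the crude bound 1 / z on
    the weight. The factor 8 is 2 for the change of the squared weight, 2 for splitting the square,
    and 2 because the two parts contribute K / 2 each. *)
Let bounded_extend T : t0 <= T -> bounded_at (K / 8) T ->
  exists2 e, 0 < e & forall t, T <= t <= T + e -> bounded_at K t.
Proof.
move=> tT bT; have T0 : 0 <= T := le_trans t00 tT.
have [_ _ ud _] := sol T0.
have [C [C0 [e1 e10 hC]]] := V_derivative_lipschitz L0 T0 M0 ud
  (fun x Tx => uM (le_trans tT Tx)).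
have K0 : 8 <= K := trap_level_ge8.
have zT := z_gt0 T.
pose a := z T ^+ 2 * (K / 8) / C.
have a0 : 0 < a by rewrite divr_gt0 // mulr_gt0 ?exprn_gt0 // divr_gt0 //; lra.
(* The three bounds keep t in the Lipschitz range, make the increment at most z(T)^2 K / 8, and let
   the squared weight at most double. *)
pose e := Num.min (Num.min (e1 / 2) (Num.sqrt a)) (4 / d * ln (Num.sqrt 2)).
have s2 : 1 < Num.sqrt 2 :> R by rewrite -[ltLHS]sqrtr1 ltr_sqrt // ltr1n.
have e0 : 0 < e.
  rewrite !lt_min; apply/andP; split; first by rewrite divr_gt0 //= sqrtr_gt0.
  by apply: mulr_gt0; [exact: divr_gt0|exact: ln_gt0].
exists e => // t /andP[Tt te] s us.
have he1 : t - T <= e1 / 2.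
  by rewrite lerBlDl; apply: le_trans te _; rewrite lerD2l !ge_min lexx.
have he2 : (t - T) ^+ 2 <= a.
  rewrite -(sqr_sqrtr (ltW a0)) lerXn2r ?nnegrE ?subr_ge0 ?sqrtr_ge0 //.
  by rewrite lerBlDl; apply: le_trans te _; rewrite lerD2l !ge_min lexx orbT.
have he3 : d / 4 * (t - T) <= ln (Num.sqrt 2).
  have h4 : t - T <= 4 / d * ln (Num.sqrt 2).
    by rewrite lerBlDl; apply: le_trans te _; rewrite lerD2l !ge_min lexx !orbT.
  apply: le_trans (ler_wpM2l _ h4) _; first by rewrite divr_ge0 // ltW.
  by rewrite mulrA [_ * (4 / d)](_ : _ = 1) ?mul1r //; field; rewrite gt_eqF.
have zr : (z T / z t) ^+ 2 <= 2.
  rewrite -(@sqr_sqrtr _ 2) // lerXn2r ?nnegrE ?sqrtr_ge0 ?divr_ge0 ?(ltW (z_gt0 _)) //.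
  rewrite /z -expRN -expRD opprK -[leRHS]lnK ?posrE ?sqrtr_gt0 // ler_expR.
  by apply: le_trans he3; rewrite le_eqVlt; apply/orP; left; apply/eqP; ring.
have Wr j : W t j ^+ 2 <= 2 * W T j ^+ 2.
  apply: (@le_trans _ _ ((z T / z t) ^+ 2 * W T j ^+ 2)); last first.
    by rewrite ler_wpM2r ?sqr_ge0.
  rewrite -exprMn lerXn2r ?nnegrE ?(ltW (W_gt0 _ _)) //.
    by rewrite mulr_ge0 ?(ltW (W_gt0 _ _)) // divr_ge0 // ltW.
  apply: gw_le_ratio => //; rewrite /z ler_expR lerN2; apply: ler_wpM2l.
    by rewrite divr_ge0 // ltW.
  by rewrite lerD2r.
have Wz j : W t j ^+ 2 <= 2 * z T ^- 2.
  apply: le_trans (Wr j) _; rewrite ler_pM2l //.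
  have zi : 0 <= (z T)^-1 by rewrite invr_ge0 ltW.
  by rewrite -exprVn lerXn2r ?nnegrE ?(ltW (W_gt0 _ _)) // gw_le_inv.
have h1 : \sum_(j <- s) kappa L j ^+ 2 * (W T j ^+ 2 * vsq (u T j)) <= K / 8 by exact: bT.
have h2 : \sum_(j <- s) kappa L j ^+ 2 * vsq (u t j - u T j) <= z T ^+ 2 * (K / 8).
  apply: le_trans (hC t _ s us) _; first by rewrite Tt /=; lra.
  by rewrite mulrC -ler_pdivlMr.
apply: (@le_trans _ _ (4 * (K / 8) + 4 * z T ^- 2 * (z T ^+ 2 * (K / 8)))); last first.
  rewrite [4 * _ * _]mulrA -[4 * _ * _]mulrA mulVf ?mulr1 ?gt_eqF ?exprn_gt0 //; lra.
have p4 : 0 <= 4 * z T ^- 2 by rewrite mulr_ge0 // invr_ge0 sqr_ge0.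
apply: le_trans (lerD (ler_wpM2l _ h1) (ler_wpM2l p4 h2)) => //.
rewrite !mulr_sumr -big_split /=; apply: ler_sum => j _.
have -> : u t j = u T j + (u t j - u T j) by rewrite addrC subrK.
have := vsqD_le (u T j) (u t j - u T j).
have -> : u T j + (u t j - u T j) - u T j = u t j - u T j by rewrite addrC addKr.
set x := vsq (u T j); set y := vsq (u t j - u T j) => hv.
have x0 : 0 <= x by exact: vsq_ge0.
have y0 : 0 <= y by exact: vsq_ge0.
have k0 := sqr_ge0 (kappa L j).
have -> : 4 * (kappa L j ^+ 2 * (W T j ^+ 2 * x)) + 4 * z T ^- 2 * (kappa L j ^+ 2 * y) =
  kappa L j ^+ 2 * (2 * W T j ^+ 2 * (2 * x) + 2 * z T ^- 2 * (2 * y)) by ring.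
apply: ler_wpM2l => //; apply: le_trans (ler_wpM2l (sqr_ge0 _) hv) _.
by rewrite mulrDr; apply: lerD; apply: ler_wpM2r => //; rewrite mulr_ge0.
Qed.

Lemma gevrey_bound t s : t0 <= t -> uniq s ->
  \sum_(j <- s) kappa L j ^+ 2 *
    (gw tau (expR (- (damping L nu alpha / 4 * (t - t0)))) (kappa L j) ^+ 2 *
     vsq (u t j)) <= trap_level.
Proof.
have K0 : 8 <= K := trap_level_ge8.
move=> tt us; suff: bounded_at K t by apply.
move: t tt {s us}; apply: real_induction => T tT h.
  move=> s us; apply: le_trans (bounded_step tT h us) _; lra.
apply: bounded_extend => //; apply: bounded_step => // t /andP[t0t tT'].
by apply: h; rewrite t0t ltW.
Qed.

End GevreyBound.

(** * Truncation to low frequencies *)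

Section LowFrequencies.
Variables (R : realType) (L : R).
Hypothesis L0 : 0 < L.
Implicit Types (j : freq) (s : seq freq).

Lemma kappaN j : kappa L (- j) = kappa L j.
Proof.
rewrite /kappa; congr (_ * Num.sqrt _); apply: eq_bigr => a _.
by rewrite !mxE intrN sqrrN.
Qed.

Lemma low_freqs (c : R) : exists s, forall j, (j \in s) = (kappa L j <= c).
Proof.
suff /finite_seqP[s es] : finite_set [set j : freq | kappa L j <= c].
  exists s => j; apply/idP/idP => h.
    by have : [set` s] j by []; rewrite -es.
  by have : [set j : freq | kappa L j <= c] j by []; rewrite es.
(* For integers |j_a| <= j_a^2, so c^2 / lambda1 bounds the coordinates without a square root. *)
pose N := Num.truncn (c ^+ 2 / lambda1 L).
pose psi (g : {ffun 'I_3 -> 'I_(N.*2.+1)}) : freq := \row_a ((g a)%:Z - N%:Z).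
apply: (@sub_finite_set _ _ (psi @` [set: {ffun 'I_3 -> 'I_(N.*2.+1)}])).
  move=> j /= jc; exists [ffun a => inord `|(j 0%R a + N)%R|%N] => //.
  apply/rowP => a; rewrite mxE ffunE.
  have ja : (`|j 0%R a| <= N)%N.
    have c0 : 0 <= c := le_trans (kappa_ge0 L0 j) jc.
    have l0 := lambda1_gt0 L0.
    rewrite truncn_ge_nat ?divr_ge0 ?sqr_ge0 ?(ltW l0) // ler_pdivlMr //.
    have : kappa L j ^+ 2 <= c ^+ 2 by rewrite lerXn2r ?nnegrE ?kappa_ge0.
    apply: le_trans; rewrite kappa_sqr mulrC ler_pM2l //.
    apply: le_trans (nsq_ge R j a).
    rewrite -[leRHS]real_normK ?num_real // -intr_norm -abszE -natrX.
    by rewrite ler_nat; case: `|_|%N => // m; rewrite -{1}[m.+1]expn1 leq_pexp2l.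
  by move: (j 0 a) ja => x xN; rewrite inordK; lia.
exact/finite_image/finite_finset.
Qed.

End LowFrequencies.

(** * Measurability of sampled functions of time *)

Section SimpleSampling.
Variables (R : realType) (t0 : R).

(** A level set is the difference of two consecutive superlevel sets, which are closed half-lines,
    or empty beyond the cap N. *)
Lemma measurable_truncn_level (c : R) (N k : nat) : 0 < c ->
  measurable [set t : R | t0 <= t /\ minn (Num.truncn (c * (t - t0))) N = k].
Proof.
move=> c0.
pose up m : set R := if (m <= N)%N then `[t0 + m%:R / c, +oo[%classic else set0.
have mup m : measurable (up m).
  by rewrite /up; case: ifP => _; [exact: measurable_itv|exact: measurable0].
have upE m t : up m t <-> t0 <= t /\ (m <= minn (Num.truncn (c * (t - t0))) N)%N.
  rewrite /up leq_min; case: ifP => mN; last by rewrite andbF; split => // -[].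
  rewrite /= in_itv /= !andbT; split=> [h|[tt]].
    have tt : t0 <= t by apply: le_trans h; rewrite lerDl divr_ge0 // ltW.
    split=> //; rewrite truncn_ge_nat ?mulr_ge0 ?subr_ge0 ?(ltW c0) //.
    by rewrite mulrC -ler_pdivrMr // lerBrDl.
  rewrite truncn_ge_nat ?mulr_ge0 ?subr_ge0 ?(ltW c0) //.
  by rewrite mulrC -ler_pdivrMr // lerBrDl.
rewrite (_ : [set t | _] = up k `\` up k.+1); first exact: measurableD.
apply/seteqP; split=> t /=.
  by move=> [tt e]; split; [apply/upE; rewrite e|move=> /upE; rewrite e ltnn => -[]].
move=> [/upE[tt k1] /upE k2]; split=> //; apply/eqP; rewrite eqn_leq k1 andbT.
by rewrite leqNgt; apply/negP => ?; apply: k2.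
Qed.

(** The cap N makes the range finite on an unbounded half-line. As g may repeat values, a preimage
    is a union of level sets. *)
Lemma simple_on_sampling (S : set (vfield R)) (g : nat -> vfield R) (c : R) (N : nat) :
  0 < c -> (forall k, S (g k)) ->
  simple_on t0 S (fun t => g (minn (Num.truncn (c * (t - t0))) N)).
Proof.
move=> c0 Sg; split.
- apply: (@sub_finite_set _ _ (g @` [set` iota 0 N.+1])).
    move=> _ [t _ <-]; exists (minn (Num.truncn (c * (t - t0))) N) => //.
    change (minn (Num.truncn (c * (t - t0))) N \in iota 0 N.+1).
    by rewrite mem_iota ltnS geq_minr.
  exact/finite_image/finite_seq.
- by [].
move=> w; rewrite (_ : _ `&` _ = \bigcup_(k in [set k | g k = w])
    [set t : R | t0 <= t /\ minn (Num.truncn (c * (t - t0))) N = k]).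
  by apply: bigcup_measurable => k _; exact: measurable_truncn_level.
apply/seteqP; split=> t /=.
  rewrite /half_line /= in_itv /= andbT => -[tt gw].
  by exists (minn (Num.truncn (c * (t - t0))) N).
move=> [k gk [tt e]]; split; first by rewrite /half_line /= in_itv /= andbT.
by rewrite e.
Qed.

End SimpleSampling.

Section Approximation.
Variables (R : realType) (L nu alpha tau K t0 : R).
Variables (u ut : R -> vfield R).
Hypotheses (L0 : 0 < L) (nu0 : 0 < nu) (alpha0 : 0 < alpha) (tau0 : 0 < tau).
Hypotheses (K0 : 0 <= K) (t00 : 0 <= t0).
Hypothesis uV : forall t, 0 <= t -> spaceV L (u t).
Hypothesis ud : forall t, 0 <= t -> V_derivative L u t (ut t).
Let del := damping L nu alpha / 4.
Let z t := expR (- (del * (t - t0))).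
Hypothesis uK : forall t s, t0 <= t -> uniq s ->
  \sum_(j <- s) kappa L j ^+ 2 * (gw tau (z t) (kappa L j) ^+ 2 * vsq (u t j)) <= K.

Let del0 : 0 < del. Proof. by apply: divr_gt0 => //; exact: damping_gt0. Qed.

Variable S : nat -> seq freq.
Hypothesis SE : forall n j, (j \in S n) = (kappa L j <= del * n%:R / tau).

Definition low_part t : vfield R := trunc (u t) (S (Num.truncn (t - t0))).

Lemma trunc_low_trig_poly n t : 0 <= t -> trig_poly L (trunc (u t) (S n)).
Proof.
move=> t_ge0; apply: trunc_trig_poly.
- exact/spaceV_real/uV.
- exact/spaceV_div_free/uV.
- exact/spaceV_mean_zero/uV.
- by move=> j; rewrite !SE kappaN.
Qed.

Let MG := Num.sqrt (16 / tau ^+ 2 * K).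

(** On the kept frequencies z <= e^(-tau k), so the weight is at least e^(tau k) / 2. The extra
    power of k is absorbed by k <= (2 / tau) e^(tau k / 2). Squaring both losses gives 4 * 4 /
    tau^2. *)
Lemma low_part_Gnorm t : t0 <= t -> (Gnorm L 2 (tau / 2) (low_part t) <= MG%:E)%E.
Proof.
move=> tt; have M0 : 0 <= MG by exact: sqrtr_ge0.
apply/(@Gnorm_leP _ _ L0 2 _ _ _ M0 isT) => s us.
have t16 : 0 <= 16 / tau ^+ 2 by rewrite divr_ge0 ?sqr_ge0.
rewrite (sqr_sqrtr (mulr_ge0 t16 K0)).
apply: le_trans (ler_wpM2l t16 (uK tt us)).
rewrite mulr_sumr; apply: ler_sum => j _.
have k0 := kappa_ge0 L0 j; have v0 := vsq_ge0 (u t j).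
rewrite /low_part /trunc; case: ifP => [|_]; last first.
  rewrite vsq0 mulr0; apply: mulr_ge0 => //.
  by apply: mulr_ge0; [exact: sqr_ge0|apply: mulr_ge0 => //; exact: sqr_ge0].
rewrite SE ler_pdivlMr // => kn.
have tn : (Num.truncn (t - t0))%:R <= t - t0.
  by rewrite truncn_le subr_ge0.
have ze : z t <= expR (- (tau * kappa L j)).
  rewrite ler_expR lerN2 mulrC; apply: le_trans kn _.
  by rewrite ler_pM2l.
set E := expR (tau / 2 * kappa L j).
have E0 : 0 < E by exact: expR_gt0.
have EE : expR (- (tau * kappa L j)) = E ^- 2.
  by rewrite expRN /E expr2 -expRD; congr ((expR _)^-1); lra.
rewrite EE in ze.
have gE : E ^+ 2 / 2 <= gw tau (z t) (kappa L j).
  rewrite /gw EE -[leLHS]invrK lef_pV2 ?posrE ?invr_gt0 ?divr_gt0 ?exprn_gt0 //.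
    by rewrite invf_div; lra.
  by apply: addr_gt0; rewrite ?expR_gt0 // invr_gt0 exprn_gt0.
have kE : tau * kappa L j <= 2 * E.
  have := expR_ge1Dx (tau / 2 * kappa L j); rewrite -/E; lra.
have kE2 : kappa L j ^+ 2 <= 4 / tau ^+ 2 * E ^+ 2.
  have tk0 : 0 <= tau * kappa L j by rewrite mulr_ge0 // ltW.
  have : (tau * kappa L j) ^+ 2 <= (2 * E) ^+ 2.
    have e0 : 0 <= 2 * E by apply: mulr_ge0 => //; exact: ltW.
    by rewrite lerXn2r ?nnegrE.
  rewrite (_ : 4 / tau ^+ 2 * E ^+ 2 = (2 * E) ^+ 2 / tau ^+ 2); last first.
    by field; rewrite gt_eqF.
  by rewrite ler_pdivlMr ?exprn_gt0 // mulrC -exprMn.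
have gE2 : E ^+ 4 <= 4 * gw tau (z t) (kappa L j) ^+ 2.
  have e20 : 0 <= E ^+ 2 / 2 by rewrite divr_ge0 ?sqr_ge0.
  have : (E ^+ 2 / 2) ^+ 2 <= gw tau (z t) (kappa L j) ^+ 2.
    by rewrite lerXn2r ?nnegrE // (le_trans e20).
  lra.
rewrite (_ : (kappa L j ^+ 2 * E) ^+ 2 * vsq (u t j) =
  kappa L j ^+ 2 * vsq (u t j) * (E ^+ 2 * kappa L j ^+ 2)); last by ring.
rewrite (_ : 16 / tau ^+ 2 * _ = kappa L j ^+ 2 * vsq (u t j) *
  (4 / tau ^+ 2 * (4 * gw tau (z t) (kappa L j) ^+ 2))); last by ring.
apply: ler_wpM2l; first by rewrite mulr_ge0 ?sqr_ge0.
apply: (@le_trans _ _ (4 / tau ^+ 2 * E ^+ 4)); last first.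
  by rewrite ler_wpM2l // divr_ge0 ?sqr_ge0.
apply: le_trans (ler_wpM2l (sqr_ge0 E) kE2) _.
by rewrite le_eqVlt; apply/orP; left; apply/eqP; ring.
Qed.

Lemma low_part_gevrey t : t0 <= t -> gevrey L 2 (tau / 2) (low_part t).
Proof.
move=> tt; split; last by apply: le_lt_trans (low_part_Gnorm tt) (ltry _).
move=> eps eps0; exists (low_part t).
  exact/trunc_low_trig_poly/(le_trans t00).
apply: (@le_lt_trans _ _ 0%E); last by rewrite lte_fin.
apply/(L2norm_leP _ (lexx 0)) => s us; rewrite big1 ?expr0n // => j _.
by rewrite -[(_ - _) j]/(low_part t j - low_part t j) subrr vsq0.
Qed.

(** A dropped frequency has tau k > del (t - t0) - del, so e^(-tau k) <= e^del z and the weight is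
    at least 1 / ((1 + e^del) z). The factor e^del is the price of rounding t - t0. *)
Lemma low_part_tail t : t0 <= t ->
  (Vnorm L 1 (u t - low_part t)%R <= ((1 + expR del) * z t * Num.sqrt K)%:E)%E.
Proof.
move=> tt; have zp : 0 < z t by exact: expR_gt0.
have ep := expR_gt0 del.
have c0 : 0 <= (1 + expR del) * z t by rewrite mulr_ge0 ?addr_ge0 // ltW.
have M0 : 0 <= (1 + expR del) * z t * Num.sqrt K by rewrite mulr_ge0 ?sqrtr_ge0.
apply/(Vnorm1_leP L0 _ M0) => s us.
rewrite [X in _ <= X]exprMn sqr_sqrtr //.
apply: le_trans (ler_wpM2l (sqr_ge0 _) (uK tt us)).
rewrite mulr_sumr; apply: ler_sum => j _; rewrite [leRHS]mulrCA.
apply: ler_wpM2l; first exact: sqr_ge0.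
have v0 := vsq_ge0 (u t j).
rewrite -[(_ - _) j]/(u t j - low_part t j) /low_part /trunc; case: ifP => [_|].
  rewrite subrr vsq0; apply: mulr_ge0; first exact: sqr_ge0.
  by apply: mulr_ge0 => //; exact: sqr_ge0.
rewrite subr0 SE => /negbT; rewrite -ltNge ltr_pdivrMr // => kn.
have tn : t - t0 < (Num.truncn (t - t0))%:R + 1.
  by rewrite natr1 truncnS_gt.
have h : 1 <= (1 + expR del) * z t * gw tau (z t) (kappa L j).
  rewrite /gw ler_pdivlMr ?addr_gt0 ?expR_gt0 // mul1r mulrDl mul1r addrC lerD2l.
  rewrite /z -expRD ler_expR mulrC.
  have := ler_wpM2l (ltW del0) (ltW tn); lra.
rewrite mulrA -exprMn ler_peMl // exprn_ege1 //.
Qed.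

Lemma low_part_cvg : Vnorm L 1 (u t - low_part t) @[t --> +oo] --> 0%E.
Proof.
apply/nbhs0_cvgeP => [t|eps eps0]; first exact: Vnorm_ge0.
pose C := (1 + expR del) * Num.sqrt K + 1.
have C0 : 0 < C by rewrite ltr_wpDl // mulr_ge0 ?sqrtr_ge0 // addr_ge0 // expR_ge0.
near=> t.
have tt : t0 <= t by near: t; apply: nbhs_pinfty_ge; rewrite num_real.
apply: le_trans (low_part_tail tt) _; rewrite lee_fin.
have zt : z t <= eps / C.
  rewrite -[leRHS]lnK ?posrE ?divr_gt0 // ler_expR lerNl.
  rewrite [X in _ <= X]mulrC -ler_pdivrMr // lerBrDl.
  by near: t; apply: nbhs_pinfty_ge; rewrite num_real.
have z0 : 0 <= z t by exact: expR_ge0.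
apply: (@le_trans _ _ (C * z t)).
  by rewrite mulrAC ler_wpM2r // lerDl.
by rewrite mulrC -ler_pdivlMr.
Unshelve. all: by end_near.
Qed.

(** The grid of step 1 / (n + 1) from t0 contains every t0 + m with m a natural number. Rounding t
    down to it therefore stays in the same unit interval, and [low_part] uses the same cutoff at
    both times. The cap stops the sampling at t0 + n + 1. *)
Let sample n t :=
  t0 + (minn (Num.truncn (n.+1%:R * (t - t0))) (n.+1 * n.+1))%:R / n.+1%:R.

Let sample_ge n t : t0 <= sample n t.
Proof. by rewrite lerDl divr_ge0. Qed.

Let sample_close n t : t0 <= t -> t - t0 <= n.+1%:R ->
  sample n t <= t < sample n t + n.+1%:R^-1 /\
  Num.truncn (sample n t - t0) = Num.truncn (t - t0).
Proof.
move=> tt tn; have d0 : 0 <= t - t0 by rewrite subr_ge0.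
have n0 : 0 < n.+1%:R :> R by [].
have c0 : 0 <= n.+1%:R * (t - t0) by rewrite mulr_ge0.
have /andP[] := truncn_itv c0; rewrite /sample.
have -> : minn (Num.truncn (n.+1%:R * (t - t0))) (n.+1 * n.+1) =
    Num.truncn (n.+1%:R * (t - t0)).
  apply/minn_idPl; rewrite -(ler_nat R); apply: le_trans (_ : n.+1%:R * (t - t0) <= _).
    by rewrite truncn_le.
  by rewrite natrM ler_pM2l.
have := truncn_ge_nat (n.+1 * Num.truncn (t - t0)) c0.
set m := Num.truncn (n.+1%:R * (t - t0)).
rewrite natrM ler_pM2l // truncn_le d0 => hm h1 h2.
have h3 : m%:R / n.+1%:R <= t - t0 by rewrite ler_pdivrMr // mulrC.
split.
  apply/andP; split; first by rewrite -lerBrDl.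
  have : t - t0 < (m%:R + 1) / n.+1%:R by rewrite ltr_pdivlMr // mulrC natr1.
  by rewrite mulrDl mul1r ltrBlDl addrA.
rewrite [t0 + _]addrC addrK; apply: truncn_def; apply/andP; split.
  by rewrite ler_pdivlMr // mulrC -natrM ler_nat hm.
by apply: le_lt_trans h3 _; have /andP[] := truncn_itv d0.
Qed.

Let sample_cvg t j : t0 <= t ->
  vsq (u (sample n t) j - u t j) @[n --> \oo] --> (0 : R).
Proof.
move=> tt; have t_ge0 : 0 <= t := le_trans t00 tt.
have [->|j0] := eqVneq j 0.
  rewrite (_ : (fun _ => _) = cst 0); first exact: cvg_cst.
  apply/funext => n /=.
  rewrite !(spaceV_mean_zero (uV _)) ?subrr ?vsq0 //.
  exact: le_trans (sample_ge n t).
apply/cvgrPdist_le => e e0.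
have [eta eta0 H] := V_derivative_continuous L0 j0 (ud t_ge0) e0.
near=> n; rewrite sub0r normrN ger0_norm ?vsq_ge0 //.
have tn : t - t0 <= n.+1%:R.
  apply: (@le_trans _ _ n%:R); last by rewrite ler_nat.
  by near: n; exact: nbhs_infty_ger.
have [/andP[s1 s2] _] := sample_close tt tn.
apply: H; first exact: le_trans (sample_ge n t).
rewrite distrC ger0_norm ?subr_ge0 // ltrBlDl; apply: lt_trans s2 _.
by rewrite ltrD2l; near: n; exact: (near_infty_natSinv_lt (PosNum eta0)).
Unshelve. all: by end_near.
Qed.

(** Once n + 1 exceeds t - t0, the sampled and the true truncation share their frequency set, so the
    Gevrey norm of the difference is controlled by a finite sum of coefficients that tend to 0 by
    continuity. *)
Lemma low_part_Linfty : Linfty_gevrey L t0 2 (tau / 2) low_part.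
Proof.
split; first by move=> t tt; exact: low_part_gevrey.
- pose g n k := low_part (t0 + k%:R / n.+1%:R).
  exists (fun n t => g n (minn (Num.truncn (n.+1%:R * (t - t0))) (n.+1 * n.+1))).
    move=> n; apply: simple_on_sampling => // k; apply: low_part_gevrey.
    by rewrite lerDl divr_ge0.
  apply: aeW => t tt; apply/nbhs0_cvgeP => [n|eps eps0]; first exact: Gnorm_ge0.
  pose m := Num.truncn (t - t0).
  pose A j := (kappa L j ^+ 2 * expR (tau / 2 * kappa L j)) ^+ 2.
  have c : \sum_(j <- undup (S m)) A j * vsq (u (sample n t) j - u t j)
      @[n --> \oo] --> \sum_(j <- undup (S m)) A j * 0.
    apply: cvg_sum_seq => j; apply: cvgM; first exact: cvg_cst.
    exact: sample_cvg.
  rewrite big1 in c; last by move=> j _; rewrite mulr0.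
  have e20 : 0 < eps ^+ 2 by rewrite exprn_gt0.
  move/cvgrPdist_le : c => /(_ _ e20) c.
  near=> n.
  have tn : t - t0 <= n.+1%:R.
    apply: (@le_trans _ _ n%:R); last by rewrite ler_nat.
    by near: n; exact: nbhs_infty_ger.
  have [_ sm] := sample_close tt tn.
  have cn : `|0 - \sum_(j <- undup (S m)) A j * vsq (u (sample n t) j - u t j)| <=
      eps ^+ 2.
    by near: n.
  apply/(@Gnorm_leP _ _ L0 2 _ _ _ (ltW eps0) isT) => s us.
  pose G j := A j * vsq ((low_part (sample n t) - low_part t) j).
  have GE j : G j = if j \in S m then A j * vsq (u (sample n t) j - u t j) else 0.
    rewrite /G -[(_ - _) j]/(low_part _ j - low_part t j) /low_part sm -/m /trunc.
    by case: ifP => // _; rewrite subrr vsq0 mulr0.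
  apply: (@le_trans _ _ (\sum_(j <- undup (S m)) G j)).
    apply: (ler_sum_uniq_support us) => j.
      by rewrite mulr_ge0 ?sqr_ge0 ?vsq_ge0.
    by rewrite mem_undup -[_ * vsq _]/(G j) GE => /negPf ->.
  rewrite sub0r normrN in cn; apply: le_trans (le_trans (ler_norm _) cn).
  rewrite big_seq [leRHS]big_seq; apply: ler_sum => j.
  by rewrite mem_undup GE => ->.
exists MG; apply: aeW => t tt; exact: low_part_Gnorm.
Unshelve. all: by end_near.
Qed.

End Approximation.

(** * Choice of the rate and conclusion *)

(* M1 with |f|_{-1} replaced by its upper bound |f|_{1,tau0} / lambda1: the rate
   tau is not allowed to depend on |f|_{-1}. *)
Definition enstrophy_radius (R : realType) (L nu alpha F : R) : R :=
  2 * (F / lambda1 L) / (alpha * nu * Num.sqrt ((lambda1 L)^-1 + alpha ^+ 2)^-1).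

(** Collects what the weighted bound asks of tau in terms free of u and t0, so that tau can be fixed
    before any solution is given. *)
Definition admissible_rate (R : realType) (tau0 L nu alpha F tau : R) : Prop :=
  0 < tau <= tau0 /\
  exists rho eta, [/\ 0 <= rho, tau * rho <= 1, 0 <= eta,
    forall s : seq freq, uniq s -> (forall j, j \in s -> rho < kappa L j) ->
      forall i, \sum_(j <- s) kappa L j ^- 2 * kappa L (j - i) ^- 2 <= eta &
    486 * (eta * trap_level L nu alpha F (enstrophy_radius L nu alpha F) ^+ 2) <= 1].

Lemma admissible_rate_exists (R : realType) (tau0 L nu alpha F : R) :
  0 < tau0 -> 0 < L -> 0 < nu -> 0 < alpha ->
  exists tau, admissible_rate tau0 L nu alpha F tau.
Proof.
move=> tau00 L0 nu0 alpha0; rewrite /admissible_rate.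
set K := trap_level _ _ _ _ _.
have K0 : 0 < K by apply: lt_le_trans (trap_level_ge8 L nu F _ alpha0).
have l0 := lambda1_gt0 L0.
(* Naming the numeral keeps the trivial-goal tactics from unfolding it in unary. *)
have [c c0 <-] : exists2 c : R, 0 < c & c = 486 by exists 486; rewrite ?ltr0n.
have cK0 : 0 < c * K ^+ 2 by rewrite mulr_gt0 // exprn_gt0.
pose eta : R := (c * K ^+ 2)^-1.
have eta0 : 0 < eta by rewrite invr_gt0.
(* Since kappa^2 is lambda1 times [nsq], the pair sums differ by the factor lambda1^2. *)
have [|rho rho0 hrho] := @lattice_pair_tail R (eta * lambda1 L ^+ 2).
  by rewrite mulr_gt0 // exprn_gt0.
pose r := Num.sqrt (lambda1 L * rho).
have r0 : 0 <= r by exact: sqrtr_ge0.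
(* Then tau r <= r / (r + 1) <= 1; the added 1 keeps the inverse meaningful when r = 0. *)
exists (Num.min tau0 (r + 1)^-1); split.
  by rewrite lt_min tau00 ge_min lexx /= invr_gt0 andbT; lra.
exists r, eta; split.
- exact: r0.
- apply: (@le_trans _ _ ((r + 1)^-1 * r)).
    by rewrite ler_wpM2r // ge_min lexx orbT.
  by rewrite mulrC ler_pdivrMr ?mul1r; lra.
- exact: ltW.
- move=> s us hs i.
  rewrite -(ler_pM2r (exprn_gt0 2 l0)); apply: le_trans (hrho s us _ i).
    rewrite mulr_suml; apply: ler_sum => j _.
    rewrite !kappa_sqr // le_eqVlt; apply/orP; left; apply/eqP.
    move: (lambda1 L) l0 (nsq R j) (nsq R (j - i)) => l l0 x y.
    rewrite !invfM [LHS](_ : _ = l^-1 ^+ 2 * l ^+ 2 * (x^-1 * y^-1)); last by ring.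
    by rewrite -exprMn mulVf ?expr1n ?mul1r // gt_eqF.
  move=> j /hs rj.
  have : r ^+ 2 < kappa L j ^+ 2 by rewrite ltrXn2r // nnegrE ?kappa_ge0.
  by rewrite kappa_sqr // (sqr_sqrtr (mulr_ge0 (ltW l0) rho0)) ltr_pM2l.
by rewrite mulrCA mulVf // gt_eqF.
Qed.

Theorem theorem2 (R : realType) (tau0 : R) (htau0 : 0 < tau0) :
  exists tau : R -> R -> R -> R -> R,
  forall (L nu alpha : R), 0 < L -> 0 < nu -> 0 < alpha ->
  forall f : vfield R, gevrey L 1 tau0 f ->
  let tau_f := tau (fine (Gnorm L 1 tau0 f)) nu (lambda1 L) alpha in
  0 < tau_f /\
  forall (uin : vfield R) (u : R -> vfield R),
    spaceV L uin -> nsv_solution L nu alpha f uin u ->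
  forall t0 : R, 0 <= t0 ->
  let d0 := ((lambda1 L)^-1 + alpha ^+ 2)^-1 in
  let M1 := 2 * fine (Vnorm L (-1) f) / (alpha * nu * Num.sqrt d0) in
  (forall t, t0 <= t -> (Vnorm L 1 (u t) <= M1%:E)%E) ->
  exists v : R -> vfield R,
    Linfty_gevrey L t0 2 tau_f v /\
    Vnorm L 1 (u t - v t) @[t --> +oo] --> 0%E.
Proof.
have [tau Htau] : exists tau : R -> R -> R -> R -> R,
    forall L nu alpha F, 0 < L -> 0 < nu -> 0 < alpha ->
    admissible_rate tau0 L nu alpha F (tau F nu (lambda1 L) alpha).
  (* The period L is a function of lambda1. *)
  pose side lam : R := 2 * pi / Num.sqrt lam.
  have [|tau Htau] := @choice (R * R * R * R)%type R (fun p tau =>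
      0 < side p.1.2 -> 0 < p.1.1.2 -> 0 < p.2 ->
      admissible_rate tau0 (side p.1.2) p.1.1.2 p.2 p.1.1.1 tau).
    move=> [[[F nu] lam] alpha] /=.
    have [[p q r]|nc] := pselect [/\ 0 < side lam, 0 < nu & 0 < alpha].
      by have [t ht] := @admissible_rate_exists R tau0 _ _ _ F htau0 p q r; exists t.
    (* A default value outside the range of positive parameters. *)
    by exists 0 => p q r; exfalso; apply: nc.
  exists (fun F nu lam alpha => tau (F, nu, lam, alpha)) => L nu alpha F L0 nu0 alpha0.
  have sL : side (lambda1 L) = L.
    rewrite /side /lambda1 sqrtr_sqr gtr0_norm ?L0' //.
    by move: (pi : R) (pi_gt0 R) => p p0; field; rewrite !gt_eqF.
  by have := Htau (F, nu, lambda1 L, alpha); rewrite /= sL; apply.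
(* Halved because [low_part_Gnorm] trades half of the rate for a power of k. *)
exists (fun F nu lam alpha => tau F nu lam alpha / 2).
move=> L nu alpha L0 nu0 alpha0 f [_ fG].
set F := fine _; set T := tau F nu (lambda1 L) alpha.
have [/andP[T0 Ttau0] [rho [eta [rho0 Trho eta0 tail small]]]] :=
  Htau L nu alpha F L0 nu0 alpha0.
rewrite -/T in T0 Ttau0 Trho.
split; first by rewrite divr_gt0.
move=> uin u _ [_ [ut sol]] t0 t00 d0 M1 uM1.
have F0 : 0 <= F by apply: fine_ge0; exact: Gnorm_ge0.
have GF : (Gnorm L 1 tau0 f <= F%:E)%E.
  by rewrite fineK // ge0_fin_numE // Gnorm_ge0.
have fF := (Gnorm_leP L0 tau0 f F0 (isT : (0 < 1)%N)).1 GF.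
have l0 := lambda1_gt0 L0.
have Fl0 : 0 <= F / lambda1 L by rewrite divr_ge0 // ltW.
(* Mode by mode, k^-2 <= lambda1^-2 k^2 because k^2 >= lambda1, and the Gevrey exponential is at
   least 1. This compares [M1] with a radius depending on f through F alone. *)
have fV : (Vnorm L (-1) f <= (F / lambda1 L)%:E)%E.
  apply/(VnormN1_leP L0 _ Fl0) => s us.
  rewrite exprMn mulrC; apply: le_trans (ler_wpM2l _ (fF s us)); last by rewrite sqr_ge0.
  rewrite mulr_sumr; apply: ler_sum => j _; rewrite mulrA.
  apply: ler_wpM2r; first exact: vsq_ge0.
  have [->|j0] := eqVneq j 0.
    by rewrite kappa0 expr0n invr0 mulr_ge0 ?sqr_ge0.
  have k0 := kappa_gt0 L0 j0; have kl := kappa_sqr_ge L0 j0.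
  rewrite [(kappa L j ^+ 1 * _) ^+ 2](_ : _ = kappa L j ^+ 2 *
    expR (tau0 * kappa L j) ^+ 2); last by ring.
  rewrite [leRHS]mulrA.
  have e1 : 1 <= expR (tau0 * kappa L j) ^+ 2.
    by rewrite exprn_ege1 // -expR0 ler_expR mulr_ge0 // ltW.
  have h : kappa L j ^- 2 <= (lambda1 L)^-1 ^+ 2 * kappa L j ^+ 2.
    have a0 : 0 <= kappa L j ^- 2 by rewrite invr_ge0 exprn_ge0 // ltW.
    have b0 : 0 <= (lambda1 L)^-1 by rewrite invr_ge0 ltW.
    have ab : kappa L j ^- 2 <= (lambda1 L)^-1 by rewrite lef_pV2 ?posrE // exprn_gt0.
    apply: (@le_trans _ _ ((kappa L j ^- 2) ^+ 2 * kappa L j ^+ 2)).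
      by rewrite le_eqVlt; apply/orP; left; apply/eqP; field; rewrite gt_eqF.
    by rewrite ler_wpM2r ?sqr_ge0 // lerXn2r ?nnegrE.
  apply: le_trans h _; rewrite ler_peMr //.
  by rewrite mulr_ge0 ?sqr_ge0.
pose M := enstrophy_radius L nu alpha F.
have den0 : 0 < alpha * nu * Num.sqrt d0.
  apply: mulr_gt0; first exact: mulr_gt0.
  rewrite sqrtr_gt0 invr_gt0 addr_gt0 ?invr_gt0 //; exact: exprn_gt0.
have M0 : 0 <= M by apply: divr_ge0; [exact: mulr_ge0|exact: ltW].
have M1M : M1 <= M.
  rewrite /M1 /M /enstrophy_radius -/d0 ler_pM2r ?invr_gt0 // ler_pM2l //.
  have ffin : Vnorm L (-1) f \is a fin_num.
    by rewrite (ge0_fin_numE (Vnorm_ge0 _ _ _)); exact: le_lt_trans fV (ltry _).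
  by rewrite -lee_fin (fineK ffin).
have uM t : t0 <= t -> (Vnorm L 1 (u t) <= M%:E)%E.
  by move=> /uM1 h; apply: le_trans h _; rewrite lee_fin.
have fF' s : uniq s ->
    \sum_(j <- s) (kappa L j * expR (tau0 * kappa L j)) ^+ 2 * vsq (f j) <= F ^+ 2.
  exact: fF.
have bound := @gevrey_bound R L nu alpha T tau0 rho eta F M t0 f u ut L0 nu0 alpha0
  (ltW T0) Ttau0 rho0 Trho eta0 M0 t00 tail fF' sol uM small.
have K0 : 0 <= trap_level L nu alpha F M.
  by apply: le_trans (bound t0 [::] (lexx _) isT); rewrite big_nil.
have [S SE] := @choice _ _ (fun (n : nat) (s : seq freq) => forall j,
    (j \in s) = (kappa L j <= damping L nu alpha / 4 * n%:R / T))
  (fun n => @low_freqs R L L0 _).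
have uV t : 0 <= t -> spaceV L (u t) by move=> /sol [].
have ud t : 0 <= t -> V_derivative L u t (ut t) by move=> /sol [].
exists (low_part t0 u S); split.
  exact: (@low_part_Linfty R L nu alpha T _ t0 u ut L0 nu0 alpha0 T0 K0 t00 uV ud
    (fun t s h => bound t s h) S SE).
exact: (@low_part_cvg R L nu alpha T _ t0 u L0 nu0 alpha0 T0 K0
    (fun t s h => bound t s h) S SE).
Qed.
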